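(* Let $p(t)$ be an irreducible Perron polynomial. Then there exist a free group $F_m$ with free basis $g_1,\dots,g_m$ and an endomorphism $\phi:F_m\to F_m$ such that for every $i=1,\dots,m$ the sequence of word lengths $\{|\phi^n(g_i)|\}_{n\ge1}$ is linearly recurrent with minimal polynomial equal to $p(t)$ times a product of cyclotomic polynomials. Consequently $\max_k\mathrm{GR}^{(k)}(\{|\phi^n(g_i)|\}_{n\ge1})=M(p)$.
   Context: A Perron polynomial is a monic polynomial with integer coefficients having a positive real root that is strictly larger than the modulus of each of its other roots. For $g$ in the free group $F_m$ with basis $g_1,\dots,g_m$, $|g|$ denotes the length of the shortest word in $g_1^{\pm1},\dots,g_m^{\pm1}$ representing $g$. A sequence is linearly recurrent if it satisfies a relation $a_{n+d}+c_{d-1}a_{n+d-1}+\cdots+c_0a_n=0$ for all $n$ with constant coefficients; its minimal polynomial is the monic polynomial $t^d+c_{d-1}t^{d-1}+\cdots+c_0$ of minimal degree arising this way. For a sequence $\mathbf{a}$ and $k\ge1$, $\mathrm{GR}^{(k)}(\mathbf{a})=\limsup_{n\to\infty}|\det H_{n,k}|^{1/n}$, where $H_{n,k}$ is the $k\times k$ matrix with $(i,j)$ entry $a_{n+i+j}$ ($0\le i,j\le k-1$); $\mathrm{GR}^{(0)}(\mathbf{a})=1$. The Mahler measure of a nonzero polynomial $f=c_dt^d+\cdots+c_0$ ($c_d\ne0$) with roots $r_j$ is $M(f)=|c_d|\prod_j\max(|r_j|,1)$. *)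

(* Defs.v *)
From HB Require Import structures.
From mathcomp Require Import all_boot all_order all_algebra.
From mathcomp Require Import algC cyclotomic.
From mathcomp Require Import complex.
From mathcomp Require Import classical_sets reals ereal sequences exp.
Set Implicit Arguments. Unset Strict Implicit. Unset Printing Implicit Defensive.
Import Order.TTheory GRing.Theory Num.Theory.
Local Open Scope ring_scope.

(* A letter is (i, false) = g_i or (i, true) = g_i^{-1}. *)
Definition letter (m : nat) := ('I_m * bool)%type.
Definition linv m (x : letter m) : letter m := (x.1, ~~ x.2).
Definition winv m (w : seq (letter m)) : seq (letter m) := rev (map (@linv m) w).

Definition push m (x : letter m) (w : seq (letter m)) : seq (letter m) :=
  if w is y :: w' then (if y == linv x then w' else x :: w) else [:: x].
Definition reduce m (w : seq (letter m)) : seq (letter m) := foldr (@push m) [::] w.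

(* |g| = length of a shortest word in g_i^{+-1} representing the element g
   (two words represent the same element iff their free reductions agree). *)
Definition wlen_pred m (g : seq (letter m)) : pred nat :=
  fun n => [exists w : n.-tuple (letter m), reduce w == reduce g].
Lemma wlen_ex m (g : seq (letter m)) : exists n, wlen_pred g n.
Proof.
exists (size g); apply/existsP; exists (in_tuple g); by [].
Qed.
Definition wlen m (g : seq (letter m)) : nat := ex_minn (wlen_ex g).

(* An endomorphism of F_m is determined by the (arbitrary) images imgs i of
   the generators g_i; it acts on words by substitution. *)
Definition endo m (imgs : 'I_m -> seq (letter m)) (w : seq (letter m)) :
  seq (letter m) :=
  flatten [seq (if x.2 then winv (imgs x.1) else imgs x.1) | x <- w].

(* lenseq imgs i k = |phi^(k+1)(g_i)|, i.e. the sequence {|phi^n(g_i)|}_{n>=1}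
   reindexed from 0. *)
Definition lenseq m (imgs : 'I_m -> seq (letter m)) (i : 'I_m) (k : nat) : nat :=
  wlen (iter k.+1 (endo imgs) [:: (i, false)]).

Definition lrec_rel (a : nat -> nat) (q : {poly algC}) : Prop :=
  forall n, \sum_(j < size q) q`_j * (a (n + j)%N)%:R = 0.
Definition linearly_recurrent (a : nat -> nat) : Prop :=
  exists q : {poly algC}, q \is monic /\ lrec_rel a q.
Definition is_min_poly (a : nat -> nat) (q : {poly algC}) : Prop :=
  [/\ q \is monic, lrec_rel a q &
      forall r : {poly algC}, r \is monic -> lrec_rel a r -> (size q <= size r)%N].

Definition perron (p : {poly int}) : Prop :=
  p \is monic /\
  exists2 r : algC, (0 < r) && root (map_poly intr p) r &
    forall z : algC, root (map_poly intr p) z -> z != r -> `|z| < r.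

Definition croots (R : realType) (f : {poly R[i]}) : seq R[i] :=
  sval (closed_field_poly_normal f).
Definition Mahler (R : realType) (f : {poly int}) : R :=
  let fc : {poly R[i]} := map_poly intr f in
  `|(lead_coef f)%:~R : R| *
    \prod_(z <- croots fc) Num.max (Normc.normc z) 1.

(* For the sequence a_n (n >= 1) stored as b k = a_(k+1):
   H_{n,k} = (a_{n+i+j})_{i,j<k} = (b (n-1+i+j)); we index n' = n-1 >= 0. *)
Definition GR (R : realType) (b : nat -> nat) (k : nat) : \bar R :=
  if k is 0 then 1%E else
  limn_esup (fun n : nat =>
    ((`|\det (\matrix_(i < k, j < k) ((b (n + i + j)%N)%:R : R))|)
       `^ (n.+1%:R^-1))%:E).

(* Main.v *)
Require Import Defs.
From HB Require Import structures.
From mathcomp Require Import all_boot all_order all_algebra.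
From mathcomp Require Import algC cyclotomic complex.
From mathcomp Require Import classical_sets reals ereal sequences exp.
From mathcomp Require Import separable boolp normedtype.
From mathcomp Require Import ring lra zify.
Import Order.TTheory GRing.Theory Num.Theory.
Local Open Scope ring_scope.
Set Implicit Arguments. Unset Strict Implicit. Unset Printing Implicit Defensive.

(* Write l for the Perron root and M for multiplication by t on Z[t]/(p).  If l = 1 then p = t - 1 and the identity of Z works.

   Let l > 1 and let H(u) be the trace of M^m u, an integer which is close to
   l^m u(l) once m is large and |u(z)| <= u(l) at the other roots z.  On pairs
   (u, a) with u in Z[t]/(p) and a = (a_0, ..., a_(N-1)) integers put
     T (u, a) = (M u; a_1, ..., a_(N-1), a_0 + H(u)).
   Its characteristic polynomial is p (t^N - 1), so n |-> (T^n (u, a))_0 is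
   killed by p (t^N - 1), whatever the functional H.  It thus suffices to find a
   finite set S of states with a_0 = 1 such that T s is, for each s in S, a sum of
   elements of S: the elements of S are then the generators, phi maps s to the
   (positive) word listing the summands of T s, and |phi^n(s)| = (T^n s)_0.

   If T s has height k = a_1, split it into the k states floor((T s + j) / k),
   0 <= j < k, coordinatewise; they add up to T s by Hermite's identity.  This
   keeps the states bounded and of positive height: with X = l^(N-m), the
   splitting preserves that the entries of a are nondecreasing, that
   |a_i X - l^i u(l)| <= e_i l^i u(l) + X for slowly varying e_i <= 1/2, that
   u(l) >= X/8, and that |u(z)| <= u(l).  All states with these properties form a
   finite set.

   A length sequence is not killed by t^N - 1, since H(M^n u) > 0; p being
   irreducible, its minimal polynomial is p times some of the Phi_n, n | N.
   The latter product is separable, hence a length sequence is a combination of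
   the powers z^n of its roots with nonzero coefficients.  Expanding the
   k x k Hankel determinant along its rows gives a combination of n-th powers of
   products of k distinct roots; for k the number of roots of modulus > 1 a single
   such product has the maximal modulus M(p), and its coefficient is the
   determinant of a product of Vandermonde and diagonal matrices. *)

(** * Lengths of positive words *)

Definition posw m (w : seq 'I_m) : seq (letter m) := [seq (i, false) | i <- w].

Lemma reduce_posw m (w : seq 'I_m) : reduce (posw w) = posw w.
Proof.
elim: w => //= i w IH; rewrite /reduce /= in IH *; rewrite IH.
by case: w {IH} => //= j w; rewrite /linv /= xpair_eqE andbF.
Qed.

Lemma size_reduce m (w : seq (letter m)) : (size (reduce w) <= size w)%N.
Proof.
elim: w => //= x w; rewrite /reduce /= => IH; set v := foldr _ _ _ in IH *.
case: v IH => //= y v IH; case: ifP => _ //=.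
by apply: leq_trans (leqW _); last exact: leqW IH.
Qed.

Lemma wlen_posw m (w : seq 'I_m) : wlen (posw w) = size w.
Proof.
rewrite /wlen; case: ex_minnP => n /existsP[t /eqP Et] minn.
apply/eqP; rewrite eqn_leq; apply/andP; split.
  rewrite -(size_map (fun i => (i, false)) w); apply: minn.
  by apply/existsP; exists (in_tuple (posw w)).
rewrite -(size_map (fun i => (i, false)) w) -[map _ _]/(posw w) -reduce_posw -Et.
by rewrite -{2}(size_tuple t) size_reduce.
Qed.

Definition subst m (f : 'I_m -> seq 'I_m) (w : seq 'I_m) : seq 'I_m :=
  flatten [seq f i | i <- w].

Lemma endo_posw m (f : 'I_m -> seq 'I_m) (w : seq 'I_m) :
  endo (fun i => posw (f i)) (posw w) = posw (subst f w).
Proof.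
by elim: w => //= i w; rewrite /endo /subst /= => ->; rewrite /posw map_cat.
Qed.

Lemma lenseq_posw m (f : 'I_m -> seq 'I_m) (i : 'I_m) (k : nat) :
  lenseq (fun i => posw (f i)) i k = size (iter k.+1 (subst f) [:: i]).
Proof.
rewrite /lenseq -[RHS]wlen_posw; congr wlen.
by elim: k.+1 => //= n ->; rewrite endo_posw.
Qed.

(** * Annihilators of sequences *)

(** ['X] acts as the shift. The sum has the shape of [lrec_rel], so that [annihilates] is
    convertible with it for sequences of naturals cast into [algC]. *)
Definition act (F : comNzRingType) (q : {poly F}) (a : nat -> F) (n : nat) : F :=
  \sum_(j < size q) q`_j * a (n + j)%N.

Section Act.
Variable F : comNzRingType.
Implicit Types (q r : {poly F}) (a b : nat -> F).

Lemma act_wide q a n m : (size q <= m)%N ->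
  act q a n = \sum_(j < m) q`_j * a (n + j)%N.
Proof.
move=> le_qm; rewrite /act (big_ord_widen _ (fun j => q`_j * a (n + j)%N) le_qm).
rewrite [LHS]big_mkcond /=; apply: eq_bigr => j _; case: ltnP => // le_qj.
by rewrite nth_default // mul0r.
Qed.

Lemma actD q r a n : act (q + r) a n = act q a n + act r a n.
Proof.
pose m := maxn (size q) (size r).
rewrite (@act_wide _ _ _ m) ?size_polyD //.
rewrite (@act_wide q _ _ m) ?leq_maxl // (@act_wide r _ _ m) ?leq_maxr //.
by rewrite -big_split; apply: eq_bigr => j _; rewrite coefD mulrDl.
Qed.

Lemma actC c a n : act c%:P a n = c * a n.
Proof.
rewrite (@act_wide _ _ _ 1) ?size_polyC ?leq_b1 //.
by rewrite big_ord1 coefC addn0.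
Qed.

Lemma actMX q a n : act (q * 'X) a n = act q a n.+1.
Proof.
rewrite (@act_wide _ _ _ (size q).+1); last first.
  by rewrite (leq_trans (size_polyMleq _ _)) // size_polyX addn2.
rewrite big_ord_recl coefMX mul0r add0r; apply: eq_bigr => j _.
by rewrite coefMX /= addSnnS.
Qed.

Lemma act_ext q a b : a =1 b -> act q a =1 act q b.
Proof. by move=> eab n; apply: eq_bigr => j _; rewrite eab. Qed.

Lemma actZ c q a n : act (c *: q) a n = c * act q a n.
Proof.
rewrite (@act_wide _ _ _ (size q)) ?size_scale_leq // big_distrr /=.
by apply: eq_bigr => j _; rewrite coefZ mulrA.
Qed.

Lemma actM q r a n : act (q * r) a n = act q (act r a) n.
Proof.
elim/poly_ind: q n => [|q c IH] n.
  by rewrite mul0r -polyC0 !actC !mul0r.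
by rewrite mulrDl -mulrA -commr_polyX mulrA mul_polyC !actD !actMX IH actZ actC.
Qed.

Lemma act0 q n : act q (fun _ => 0) n = 0.
Proof. by rewrite /act big1 // => j _; rewrite mulr0. Qed.

Lemma act_Xn a n m : act 'X^m a n = a (n + m)%N.
Proof.
elim: m n => [|m IH] n; first by rewrite expr0 -polyC1 actC mul1r addn0.
by rewrite exprSr actMX IH addSnnS.
Qed.

Lemma act_XsubC q z a : act (q * ('X - z%:P)) a =1 act q (fun n => a n.+1 - z * a n).
Proof.
move=> n; rewrite actM; apply: act_ext => k.
by rewrite -[- _]polyCN -['X]mul1r actD actMX -polyC1 !actC mul1r mulNr.
Qed.

End Act.

Lemma act_map (F K : comNzRingType) (f : {rmorphism F -> K}) (q : {poly F}) a n :
  act (map_poly f q) (fun k => f (a k)) n = f (act q a n).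
Proof.
rewrite (@act_wide _ _ _ _ (size q)) ?size_poly // /act rmorph_sum.
by apply: eq_bigr => j _; rewrite coef_map rmorphM.
Qed.

Definition annihilates (F : comNzRingType) (q : {poly F}) (a : nat -> F) : Prop :=
  forall n, act q a n = 0.

Lemma annihilates_mull (F : comNzRingType) (g q : {poly F}) a :
  annihilates q a -> annihilates (g * q) a.
Proof.
by move=> qa n; rewrite actM -[RHS](act0 g n); apply: act_ext => k; apply: qa.
Qed.

Lemma annihilates_dvdp (F : fieldType) (q r : {poly F}) a :
  q %| r -> annihilates q a -> annihilates r a.
Proof. by case/dvdpP => g ->; apply: annihilates_mull. Qed.

Lemma annihilates_gcdp (F : fieldType) (q r : {poly F}) a :
  annihilates q a -> annihilates r a -> annihilates (gcdp q r) a.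
Proof.
move=> qa ra; have [[u v] /= /eqp_dvdl] := Bezoutp q r.
move=> /(_ (gcdp q r)); rewrite dvdpp; move=> H; apply: annihilates_dvdp H _ => n.
by rewrite actD (annihilates_mull _ qa) (annihilates_mull _ ra) addr0.
Qed.

(** * Irreducible factors and minimal annihilators *)

Lemma irreducible_coprimep (F : fieldType) (f r : {poly F}) :
  irreducible_poly f -> ~~ (f %| r) -> coprimep f r.
Proof.
case=> f_gt1 irr_f; apply: contraNT => ncop; rewrite coprimep_def in ncop.
by rewrite -(eqp_dvdl _ (irr_f _ ncop (dvdp_gcdl f r))) dvdp_gcdr.
Qed.

Lemma map_poly_ratr_intr (K : numFieldType) (q : {poly int}) :
  map_poly ratr (map_poly intr q : {poly rat}) = map_poly intr q :> {poly K}.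
Proof. by rewrite -map_poly_comp; apply: eq_map_poly => c /=; rewrite rmorph_int. Qed.

(** ['Phi_n] is the minimal polynomial of a primitive root [z]. If it is [g * q], one factor
    vanishes at [z] and is therefore divisible by the whole; for [g] this would leave [q]
    constant. *)
Lemma Cyclotomic_irreducible n : (0 < n)%N ->
  irreducible_poly (map_poly intr 'Phi_n : {poly rat}).
Proof.
move=> n_gt0; have [z prim_z] := C_prim_root_exists n_gt0.
have [f [Df mon_f] dv_f] := minCpolyP z.
have -> : map_poly intr 'Phi_n = f.
  apply: (map_inj_poly (fmorph_inj (ratr : rat -> algC)) (rmorph0 _)).
  by rewrite map_poly_ratr_intr -Df (minCpoly_cyclotomic prim_z) -(Cintr_Cyclotomic prim_z).
have f_gt1 : (1 < size f)%N by rewrite -(size_map_poly (ratr : rat -> algC)) -Df size_minCpoly.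
have f0 : f != 0 by rewrite monic_neq0.
split=> // q q_neq1 /dvdpP[g Dg]; have := root_minCpoly z.
have [q0 g0] : q != 0 /\ g != 0.
  by move: f0; rewrite Dg mulf_eq0 negb_or => /andP[].
rewrite {1}Df Dg rmorphM rootM !dv_f => /orP[] f_dv.
  have := dvdp_leq g0 f_dv; rewrite {1}Dg size_mul //.
  rewrite -(size_poly_eq0 q) in q0; rewrite -(size_poly_eq0 g) in g0.
  by move: q0 g0 (q_neq1); move: (size q) (size g) => k l; lia.
by apply/andP; split; rewrite ?dvdp_mull // -Dg.
Qed.

Section MinPoly.
Variables (p : {poly rat}) (a : nat -> rat).
Hypothesis irr_p : irreducible_poly p.
Let Psi (s : seq nat) : {poly rat} := \prod_(n <- s) map_poly intr 'Phi_n.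

(** Cyclotomic factors are deleted as long as the remaining product annihilates [a]; the length
    bound [b] drives the induction. The factor [p] survives, because [Psi s] alone never annihilates
    [a]. Once nothing can be deleted, each irreducible factor divides every annihilator, and
    separability makes the factors coprime, so their product divides it too. *)
Lemma cyclotomic_cofactor s : all (fun n => 0 < n)%N s ->
    separable_poly (p * Psi s) -> annihilates (p * Psi s) a -> ~ annihilates (Psi s) a ->
  exists2 s', all (fun n => 0 < n)%N s' &
    [/\ separable_poly (p * Psi s'), annihilates (p * Psi s') a &
       forall r, annihilates r a -> p * Psi s' %| r].
Proof.
move: {2}(size s) (leqnn (size s)) => b; elim: b s => [|b IH] s le_sb s_gt0 sep_s ann_s nann_s.
  case: s le_sb s_gt0 sep_s ann_s nann_s => // _ _ sep_s ann_s nann_s.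
  exists [::] => //; have Psi0 : Psi [::] = 1 by rewrite /Psi big_nil.
  rewrite Psi0 mulr1 in ann_s nann_s *; rewrite Psi0 mulr1 in sep_s; split=> // r ann_r.
  apply/negbNE/negP => /(irreducible_coprimep irr_p) cop; apply: nann_s.
  apply: annihilates_dvdp (annihilates_gcdp ann_s ann_r).
  by rewrite dvdp1.
have [[n ns ann_n] | nrem] := pselect (exists2 n, n \in s & annihilates (p * Psi (rem n s)) a).
  have DPsi : Psi s = map_poly intr 'Phi_n * Psi (rem n s) by rewrite /Psi (big_rem n).
  apply: (IH (rem n s)) => //.
  - by rewrite size_rem // -ltnS prednK //; case: (s) ns.
  - by apply/allP => k /mem_rem /(allP s_gt0).
  - by apply: dvdp_separable sep_s; rewrite dvdp_mul // DPsi dvdp_mull.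
  - by move=> H; apply: nann_s; rewrite DPsi; apply: annihilates_mull.
exists s => //; split=> // r ann_r.
(* Were [f] not a divisor of [r], the gcd of [r] and [f * g] would be prime to [f], hence divide
   [g], and [g] would annihilate [a]. *)
have dvd_factor f g : irreducible_poly f -> p * Psi s = f * g -> ~ annihilates g a -> f %| r.
  move=> irr_f Dfg nann_g; apply/negbNE/negP => /(irreducible_coprimep irr_f) cop.
  apply: nann_g; apply: annihilates_dvdp (annihilates_gcdp ann_s ann_r).
  rewrite Dfg -(@Gauss_dvdpr _ _ f) ?dvdp_gcdl // coprimep_sym.
  by apply: coprimep_dvdl cop; rewrite dvdp_gcdr.
have p_dv : p %| r by apply: dvd_factor (erefl _) nann_s.
have Phi_dv n : n \in s -> map_poly intr 'Phi_n %| r.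
  move=> ns; apply: (dvd_factor _ (p * Psi (rem n s))).
  - by apply/Cyclotomic_irreducible/(allP s_gt0).
  - by rewrite /Psi (big_rem n) //= mulrCA.
  - by move=> ann_n; apply: nrem; exists n.
have := sep_s; rewrite separable_mul => /and3P[_ sep_Psi cop].
rewrite Gauss_dvdp // p_dv /=.
elim: (s) Phi_dv sep_Psi => [|n t IHt] dv_t; first by rewrite /Psi big_nil dvd1p.
rewrite /Psi big_cons separable_mul => /and3P[_ sep_t cop_t].
rewrite Gauss_dvdp // dv_t ?mem_head //=; apply: IHt => // k kt.
by apply: dv_t; rewrite inE kt orbT.
Qed.

End MinPoly.

Lemma annihilated_eq0 (F : comNzRingType) (q : {poly F}) (b : nat -> F) :
    q \is monic -> annihilates q b -> (forall n, (n < (size q).-1)%N -> b n = 0) ->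
  forall n, b n = 0.
Proof.
move=> mon_q qb b0; elim/ltn_ind => n IH; have [/b0 // | le_qn] := ltnP n (size q).-1.
have := qb (n - (size q).-1)%N.
rewrite (@act_wide _ _ _ _ (size q).-1.+1) ?leqSpred // big_ord_recr /=.
rewrite subnK // -lead_coefE (monicP mon_q) mul1r big1 ?add0r // => j _.
by rewrite IH ?mulr0 // -{2}(subnK le_qn) ltn_add2l.
Qed.

(** A larger field allows no shorter recurrence: the coefficients of one solve a linear system over
    the rationals, so a rational solution exists as well. The first [D] equations suffice, as [q]
    propagates them. *)
Lemma annihilator_size (K : fieldType) (f : {rmorphism rat -> K})
    (q : {poly rat}) (a : nat -> rat) (r : {poly K}) :
    q \is monic -> annihilates q a -> (forall g, annihilates g a -> q %| g) ->
    r \is monic -> annihilates r (fun n => f (a n)) ->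
  (size q <= size r)%N.
Proof.
move=> mon_q qa q_min mon_r ra; rewrite leqNgt; apply/negP => lt_rq.
have [k Dk] : exists k, size r = k.+1.
  by exists (size r).-1; rewrite prednK // size_poly_gt0 monic_neq0.
pose D := (size q).-1.
pose B : 'M[rat]_(k, D) := \matrix_(j, n) a (n + j)%N.
pose v : 'rV[rat]_D := \row_n a (n + k)%N.
have : (map_mx f v <= map_mx f B)%MS.
  apply/submxP; exists (\row_j - r`_j); apply/rowP => n; rewrite !mxE.
  have rk : r`_k = 1 by rewrite -(monicP mon_r) lead_coefE Dk.
  have := ra n; rewrite /act Dk big_ord_recr /= rk.
  rewrite mul1r addrC => /eqP; rewrite addr_eq0 => /eqP ->.
  by rewrite -sumrN; apply: eq_bigr => j _; rewrite !mxE mulNr.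
rewrite map_submx => /submxP[u Du].
pose w := \sum_(j < k) u 0 j *: 'X^j.
have sz_w : (size w <= k)%N.
  apply: (leq_trans (size_sum _ _ _)); apply/bigmax_leqP => j _.
  by rewrite (leq_trans (size_scale_leq _ _)) // size_polyXn.
have ann_r0 : annihilates ('X^k - w) a.
  pose b n := act ('X^k - w) a n.
  apply: (annihilated_eq0 mon_q (b := b)) => [n | n lt_nD].
    by rewrite -actM mulrC actM -[RHS](act0 ('X^k - w) n); apply: act_ext => l; apply: qa.
  rewrite /b actD act_Xn -scaleN1r actZ.
  have /rowP/(_ (Ordinal lt_nD)) := Du; rewrite !mxE /= => ->.
  have -> : act w a n = \sum_(j < k) u 0 j * a (n + j)%N.
    rewrite /w; elim/big_ind2: _ => [|x1 x2 y1 y2 <- <-|j _]; first by rewrite -polyC0 actC mul0r.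
      by rewrite actD.
    by rewrite actZ act_Xn.
  by rewrite mulN1r; apply/eqP; rewrite subr_eq0; apply/eqP/eq_bigr => j _; rewrite mxE.
have sz_r0 : size ('X^k - w) = k.+1.
  by rewrite size_polyDl size_polyXn // size_polyN ltnS.
have := dvdp_leq _ (q_min _ ann_r0); rewrite -size_poly_eq0 sz_r0 => /(_ isT).
by rewrite leqNgt -Dk lt_rq.
Qed.

(** * Sequences as combinations of powers *)

Lemma act_geometric (F : comNzRingType) (q : {poly F}) (z : F) n :
  act q (fun k => z ^+ k) n = q.[z] * z ^+ n.
Proof.
rewrite horner_coef big_distrl /=; apply: eq_bigr => j _.
by rewrite exprD mulrCA mulrC -mulrA.
Qed.

(** Induction on the roots: ['X - z] removes one of them, the resulting first-order recurrence has
    the particular solution [e], and [a - e] is geometric with ratio [z]. *)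
Lemma exponential_sum (F : fieldType) (rs : seq F) (a : nat -> F) :
    uniq rs -> annihilates (\prod_(z <- rs) ('X - z%:P)) a ->
  exists c : F -> F, forall n, a n = \sum_(z <- rs) c z * z ^+ n.
Proof.
elim: rs a => [|z rs IH] a /=.
  move=> _ a0; exists (fun=> 0) => n; have := a0 n.
  by rewrite !big_nil -polyC1 actC mul1r.
case/andP=> z_rs uniq_rs; rewrite big_cons mulrC => ann_a.
have [c Dc] : exists c : F -> F, forall n, a n.+1 - z * a n = \sum_(z <- rs) c z * z ^+ n.
  by apply: IH => // n; rewrite -act_XsubC.
pose e n := \sum_(w <- rs) c w / (w - z) * w ^+ n.
have De n : e n.+1 - z * e n = a n.+1 - z * a n.
  rewrite Dc /e big_distrr /= -sumrB; apply: eq_big_seq => w w_rs.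
  have wz : w - z != 0 by rewrite subr_eq0; apply: contraNneq z_rs => <-.
  by rewrite exprS; field.
have Da n : a n - e n = (a 0%N - e 0%N) * z ^+ n.
  elim: n => [|n IHn]; first by rewrite mulr1.
  rewrite exprSr mulrA -IHn; have := De n; move: (a n.+1) (e n.+1) => x y H.
  by apply/eqP; rewrite -subr_eq0; apply/eqP; rewrite -[RHS](subrr (x - z * a n)) -{2}H; ring.
exists (fun w => if w == z then a 0%N - e 0%N else c w / (w - z)) => n.
rewrite big_cons eqxx -Da [X in _ = _ + X](_ : _ = e n) ?subrK //.
by apply: eq_big_seq => w w_rs; case: eqP z_rs => // <-; rewrite w_rs.
Qed.

Lemma exponential_sum_neq0 (F : fieldType) (rs : seq F) (a : nat -> F) (c : F -> F) :
    uniq rs -> (forall n, a n = \sum_(z <- rs) c z * z ^+ n) ->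
    (forall r : {poly F}, r \is monic -> annihilates r a -> (size rs < size r)%N) ->
  forall z, z \in rs -> c z != 0.
Proof.
move=> uniq_rs Da min_rs z z_rs; apply/eqP => cz0.
pose r := \prod_(w <- rem z rs) ('X - w%:P).
have sz_rs : (0 < size rs)%N by case: (rs) z_rs.
have ann_r : annihilates r a.
  move=> n; rewrite (act_ext r Da).
  rewrite /act; under eq_bigr do rewrite big_distrr /=.
  rewrite exchange_big /= big1_seq // => w /andP[_ w_rs].
  have -> : \sum_(i < size r) r`_i * (c w * w ^+ (n + i)) = c w * act r (fun k => w ^+ k) n.
    by rewrite big_distrr /=; apply: eq_bigr => j _; rewrite mulrCA.
  rewrite act_geometric; have [-> | wz] := eqVneq w z; first by rewrite cz0 mul0r.
  have /rootP -> : root r w; last by rewrite mul0r mulr0.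
  by rewrite root_prod_XsubC mem_rem_uniq // inE wz.
have := min_rs r (monic_prod_XsubC _ _ _) ann_r.
by rewrite size_prod_XsubC size_rem // prednK // ltnn.
Qed.

(** * Hankel determinants *)

(** Bernoulli's inequality for [1 + e / y], multiplied by [y ^+ n.+1] so that [y = 0] needs no
    exception. *)
Lemma bernoulli_exp (F : realFieldType) (y e : F) n : 0 <= y -> 0 <= e ->
  y ^+ n * (y + n%:R * e) <= (y + e) ^+ n * y.
Proof.
move=> y0 e0; elim: n => [|n IH]; first by rewrite !expr0 mul0r addr0.
have := ler_wpM2l (addr_ge0 y0 e0) IH; rewrite !mulrA -exprS; apply: le_trans.
rewrite exprSr -natr1 -subr_ge0.
have -> : (y + e) * y ^+ n * (y + n%:R * e) - y ^+ n * y * (y + (n%:R + 1) * e)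
  = y ^+ n * (n%:R * (e * e)) by ring.
by rewrite mulr_ge0 ?exprn_ge0 // mulr_ge0 ?mulr_ge0.
Qed.

Lemma geometric_dominates (F : archiRealFieldType) (A y M : F) :
  0 <= y -> y < M -> exists n0, forall n, (n0 <= n)%N -> A * y ^+ n <= M ^+ n.
Proof.
move=> y0 yM; have M0 : 0 < M by apply: le_lt_trans yM.
have [y_eq0 | y_neq0] := eqVneq y 0.
  by exists 1%N => -[//|n] _; rewrite y_eq0 expr0n mulr0 exprn_ge0 // ltW.
have y_gt0 : 0 < y by rewrite lt_def y_neq0.
pose e := M - y; have e0 : 0 < e by rewrite subr_gt0.
exists (Num.bound `|A * y / e|) => n le_n.
rewrite -(ler_pM2r y_gt0); have -> : M = y + e by rewrite addrC subrK.
apply: le_trans (bernoulli_exp n y0 (ltW e0)).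
rewrite [A * _]mulrC -mulrA ler_pM2l ?exprn_gt0 //.
have : A * y / e < n%:R.
  apply: le_lt_trans (ler_norm _) _; apply: lt_le_trans (archi_boundP (normr_ge0 _)) _.
  by rewrite ler_nat.
by rewrite ltr_pdivrMr // => /ltW /le_trans; apply; rewrite lerDr ltW.
Qed.

Section Hankel.
Variables (K : comNzRingType) (D : nat) (g x : 'I_D -> K).

Definition hankel k n : 'M[K]_k :=
  \matrix_(i, l) \sum_(d < D) g d * x d ^+ (n + i + l).

(** The determinant at [n = 0] of the matrix that keeps, in row [i], only the term of index
    [f i]. *)
Definition hankel_weight k (f : {ffun 'I_k -> 'I_D}) : K :=
  (\prod_i (g (f i) * x (f i) ^+ i)) * \det (\matrix_(i < k, l < k) x (f i) ^+ l).

(* Multilinearity in the rows; a non-injective f repeats a row. *)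
Lemma det_hankel k n : \det (hankel k n) =
  \sum_(f : {ffun 'I_k -> 'I_D} | injectiveb f)
     hankel_weight f * (\prod_i x (f i)) ^+ n.
Proof.
have -> : \det (hankel k n) = \sum_(f : {ffun 'I_k -> 'I_D})
     hankel_weight f * (\prod_i x (f i)) ^+ n.
  rewrite /determinant.
  under eq_bigr do [under eq_bigr do rewrite mxE; rewrite bigA_distr_bigA big_distrr /=].
  rewrite exchange_big /=; apply: eq_bigr => f _.
  rewrite /hankel_weight /determinant big_distrr big_distrl /=; apply: eq_bigr => s _.
  rewrite -prodrXl [RHS]mulrC mulrA mulrCA; congr (_ * _).
  rewrite -!big_split; apply: eq_bigr => i _; rewrite mxE /=.
  by rewrite !exprD; ring.
rewrite [RHS]big_mkcond; apply: eq_bigr => f _ /=; case: injectiveP => // ninj.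
have [i [j ij fij]] : exists i, exists2 j, i != j & f i = f j.
  apply: contrapT => H; apply: ninj => i j fij; apply/eqP/negP => ij.
  by apply: H; exists i, j => //; apply/negP.
rewrite /hankel_weight (determinant_alternate ij) ?mulr0 ?mul0r // => l.
by rewrite !mxE fij.
Qed.

End Hankel.

Section HankelGrowth.
Variables (R : realType) (D : nat) (g x : 'I_D -> R[i]).
Hypothesis x_inj : injective x.
Hypothesis g_neq0 : forall d, g d != 0.
Local Notation N := (@Normc.normc R).

Let norm_ge0 z : 0 <= N z. Proof. by case: z => a b; apply: sqrtr_ge0. Qed.
Let norm_gt0 z : z != 0 -> 0 < N z.
Proof.
by move=> z0; rewrite lt_def norm_ge0 andbT; apply: contraNneq z0 => /Normc.eq0_normc ->.
Qed.
Let norm_sum I (r : seq I) (P : pred I) (F : I -> R[i]) :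
  N (\sum_(i <- r | P i) F i) <= \sum_(i <- r | P i) N (F i).
Proof.
elim/big_ind2: _ => [|a b c d ab cd|//]; first by rewrite Normc.normc0.
by apply: le_trans (le_normcD _ _) (lerD ab cd).
Qed.
Let norm_prod I (r : seq I) (P : pred I) (F : I -> R[i]) :
  N (\prod_(i <- r | P i) F i) = \prod_(i <- r | P i) N (F i).
Proof.
by elim/big_ind2: _ => [|a b c d <- <-|//]; rewrite ?Normc.normc1 ?Normc.normcM.
Qed.
Let norm_exp z n : N (z ^+ n) = N z ^+ n.
Proof. by elim: n => [|n IH]; rewrite ?expr0 ?Normc.normc1 // !exprS Normc.normcM IH. Qed.

Let m d := Num.max (N (x d)) 1.
Let m_ge1 d : 1 <= m d. Proof. by rewrite le_max lexx orbT. Qed.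
Let m_gt0 d : 0 < m d. Proof. exact: lt_le_trans (m_ge1 d). Qed.
Let M := \prod_d m d.

Let M_ge1 (A : {set 'I_D}) : 1 <= \prod_(d in A) m d.
Proof. by elim/big_ind: _ => // a b a1 b1; rewrite mulr_ege1. Qed.
Let M_gt0 (A : {set 'I_D}) : 0 < \prod_(d in A) m d.
Proof. exact: lt_le_trans (M_ge1 A). Qed.
Let M_split (A : {set 'I_D}) : M = \prod_(d in A) m d * \prod_(d in ~: A) m d.
Proof.
rewrite /M (bigID (mem A)) /=; congr (_ * _); apply: eq_bigl => d.
by rewrite inE.
Qed.

Let Mgt0 : 0 < M.
Proof. by rewrite (M_split [set: 'I_D]%SET) mulr_gt0. Qed.

Let prod_norm k (f : {ffun 'I_k -> 'I_D}) : injective f ->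
  N (\prod_i x (f i)) <= \prod_(d in f @: 'I_k) m d.
Proof.
move=> f_inj; rewrite norm_prod big_imset /=; last by move=> i j _ _ /f_inj.
by apply: ler_prod => i _; rewrite norm_ge0 le_max lexx.
Qed.

Lemma det_hankel_le k : exists A, forall n, N (\det (hankel g x k n)) <= A * M ^+ n.
Proof.
exists (\sum_(f : {ffun 'I_k -> 'I_D} | injectiveb f) N (hankel_weight g x f)) => n.
rewrite det_hankel (le_trans (norm_sum _ _ _)) // big_distrl /=.
apply: ler_sum => f /injectiveP f_inj; rewrite Normc.normcM norm_exp.
rewrite ler_wpM2l // lerXn2r ?nnegrE ?(ltW Mgt0) //.
apply: le_trans (prod_norm f_inj) _; rewrite (M_split (f @: 'I_k)).
by rewrite ler_peMr // ltW.
Qed.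

Let J : {set 'I_D} := [set d | 1 < N (x d)].

Let M_J : M = N (\prod_(d in J) x d).
Proof.
rewrite (M_split J) norm_prod [X in _ * X]big1 ?mulr1 => [|d].
  by apply: eq_bigr => d; rewrite inE /m => /ltW /max_idPl ->.
by rewrite !inE -leNgt => /max_idPr.
Qed.

(** Setting the coefficients outside [J] to zero turns the sum into a Hankel determinant with as
    many roots as rows. It factors as a Vandermonde matrix, a diagonal matrix and the transposed
    Vandermonde matrix, all invertible. *)
Let hankel_weight_J_neq0 :
  \sum_(f : {ffun 'I_#|J| -> 'I_D} | injectiveb f && [forall i, f i \in J])
     hankel_weight g x f != 0.
Proof.
pose g' d := if d \in J then g d else 0.
have -> : \sum_(f : {ffun 'I_#|J| -> 'I_D} | injectiveb f && [forall i, f i \in J])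
     hankel_weight g x f = \det (hankel g' x #|J| 0).
  rewrite det_hankel big_mkcondr; apply: eq_bigr => f _; rewrite expr0 mulr1.
  rewrite /hankel_weight; case: forallP => [fJ | nfJ].
    by congr (_ * _); apply: eq_bigr => i _; rewrite /g' fJ.
  have [i fi] : exists i, f i \notin J.
    by apply: contrapT => H; apply: nfJ => i; apply/negPn/negP => fi; apply: H; exists i.
  by rewrite (bigD1 i) //= /g' (negPf fi) !mul0r.
pose e (j : 'I_#|J|) := enum_val j.
pose V := Vandermonde #|J| (\row_j x (e j)).
have -> : hankel g' x #|J| 0 = V *m diag_mx (\row_j g (e j)) *m V^T.
  apply/matrixP => i l; rewrite mxE [RHS]mxE.
  under [RHS]eq_bigr => j _ do rewrite mul_mx_diag !mxE.
  transitivity (\sum_(d in J) g d * x d ^+ (i + l)).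
    rewrite [RHS]big_mkcond; apply: eq_bigr => d _ /=; rewrite /g' add0n.
    by case: ifP; rewrite ?mul0r.
  by rewrite big_enum_val; apply: eq_bigr => j _; rewrite exprD mulrCA mulrA.
have V0 : \det V != 0.
  rewrite det_Vandermonde; apply/prodf_neq0 => i _; apply/prodf_neq0 => j ij.
  rewrite !mxE subr_eq0; apply: contraTneq ij => /x_inj/enum_val_inj ->.
  by rewrite ltnn.
rewrite !det_mulmx det_tr det_diag !mulf_neq0 //.
by apply/prodf_neq0 => j _; rewrite mxE.
Qed.

(** For [k = #|J|], every injective [f] with values in [J] is onto [J], so its product is the one of
    modulus [M]; these terms have total weight [W]. Any other injective [f] misses some [d] in [J],
    which costs at least the factor [m d > 1]. *)
Lemma det_hankel_ge : exists k c n0, 0 < c /\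
  forall n, (n0 <= n)%N -> c * M ^+ n <= N (\det (hankel g x k n)).
Proof.
pose P (f : {ffun 'I_#|J| -> 'I_D}) := [forall i, f i \in J].
pose W := \sum_(f : {ffun 'I_#|J| -> 'I_D} | injectiveb f && P f) hankel_weight g x f.
pose S := \sum_(f : {ffun 'I_#|J| -> 'I_D} | injectiveb f && ~~ P f) N (hankel_weight g x f).
pose y := \big[Num.max/0]_(d in J) (M / m d).
have y0 : 0 <= y by apply: bigmax_ge_id.
have yM : y < M.
  apply/bigmax_ltP; split=> // d; rewrite inE => d1.
  by rewrite ltr_pdivrMr // ltr_pMr // /m lt_max d1.
have W0 : 0 < N W by apply/norm_gt0/hankel_weight_J_neq0.
(* The constant is chosen so that the remaining terms, at most [S * y ^+ n], use up at most half of
   the dominant one. *)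
have [n0 Hn0] := geometric_dominates (S * 2 / N W) y0 yM.
exists #|J|, (N W / 2), n0; split=> [|n le_n]; first by rewrite divr_gt0.
have Dgood (f : {ffun 'I_#|J| -> 'I_D}) : injective f -> P f ->
    \prod_i x (f i) = \prod_(d in J) x d.
  move=> f_inj /forallP fJ; have fJE : f @: 'I_#|J| = J.
    apply/eqP; rewrite eqEcard card_imset // card_ord leqnn andbT.
    by apply/fintype.subsetP => _ /imsetP[i _ ->].
  by rewrite -[in RHS]fJE big_imset //= => i j _ _ /f_inj.
have Dbad (f : {ffun 'I_#|J| -> 'I_D}) : injective f -> ~~ P f -> N (\prod_i x (f i)) <= y.
  move=> f_inj nPf; apply: le_trans (prod_norm f_inj) _.
  have [d dJ df] : exists2 d, d \in J & d \notin f @: 'I_#|J|.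
    apply: contrapT => H; case/negP: nPf; apply/forallP => i.
    have JE : J =i f @: 'I_#|J|.
      apply/setP; apply/eqP; rewrite eqEcard card_imset // card_ord leqnn andbT.
      by apply/fintype.subsetP => d dJ; apply/negPn/negP => df; apply: H; exists d.
    by rewrite JE imset_f.
  apply: le_trans (le_bigmax_cond _ _ dJ).
  rewrite ler_pdivlMr // (M_split (f @: 'I_#|J|)) ler_pM2l //.
  rewrite (bigD1 d) ?inE //= ler_peMr ?(ltW (m_gt0 d)) //.
  by elim/big_ind: _ => // a b a1 b1; rewrite mulr_ege1.
have -> : \det (hankel g x #|J| n) = W * (\prod_(d in J) x d) ^+ n +
    \sum_(f : {ffun 'I_#|J| -> 'I_D} | injectiveb f && ~~ P f)
      hankel_weight g x f * (\prod_i x (f i)) ^+ n.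
  rewrite det_hankel (bigID P) /=; congr (_ + _); rewrite /W big_distrl /=.
  by apply: eq_bigr => f /andP[/injectiveP f_inj Pf]; rewrite Dgood.
set E := \sum_(f | _) _.
have NE : N E <= S * y ^+ n.
  rewrite (le_trans (norm_sum _ _ _)) // big_distrl /=.
  apply: ler_sum => f /andP[/injectiveP f_inj nPf]; rewrite Normc.normcM norm_exp.
  by rewrite ler_wpM2l // lerXn2r ?nnegrE // Dbad.
have NE2 : N E <= N W / 2 * M ^+ n.
  apply: le_trans NE _; have := ler_wpM2l (ltW (divr_gt0 W0 (ltr0n _ 2))) (Hn0 n le_n).
  by rewrite mulrA; have -> : N W / 2 * (S * 2 / N W) = S by field; rewrite gt_eqF.
have : N (W * (\prod_(d in J) x d) ^+ n) <= N (W * (\prod_(d in J) x d) ^+ n + E) + N (- E).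
  by rewrite -{1}[W * _](addrK E) le_normcD.
rewrite normcN Normc.normcM norm_exp -M_J.
by move: NE2; move: (N (_ + E)) (N E) (M ^+ n) (N W) => *; nra.
Qed.

End HankelGrowth.

(** * Growth rates *)

Lemma limn_esup_le (R : realType) (u : nat -> \bar R) l n0 :
  (forall n, (n0 <= n)%N -> (u n <= l)%E) -> (limn_esup u <= l)%E.
Proof.
move=> ul; rewrite limn_esup_lim; apply: lime_le; first exact: is_cvg_esups.
exists n0 => // n /= le_n; apply: ge_ereal_sup => _ [k /= nk <-].
by apply: ul; apply: leq_trans nk.
Qed.

Lemma limn_esup_ge (R : realType) (u : nat -> \bar R) l n0 :
  (forall n, (n0 <= n)%N -> (l <= u n)%E) -> (l <= limn_esup u)%E.
Proof.
move=> ul; rewrite limn_esup_lim; apply: lime_ge; first exact: is_cvg_esups.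
exists n0 => // n /= le_n; apply: (@le_trans _ _ (u n)); first exact: ul.
by apply: ereal_sup_ubound; exists n => /=.
Qed.

Lemma powR_root (R : realType) (y : R) n : 0 <= y -> (y ^+ n.+1) `^ (n.+1%:R^-1) = y.
Proof.
by move=> y0; rewrite -powR_mulrn // -powRrM mulfV ?powRr1 //.

Qed.

Section RootGrowth.
Variables (R : realType) (u : nat -> R) (M : R).
Hypotheses (u_ge0 : forall n, 0 <= u n) (M_gt0 : 0 < M).

Lemma limn_esup_root_le A : (forall n, u n <= A * M ^+ n) ->
  (limn_esup (fun n => (u n `^ (n.+1%:R^-1))%:E) <= M%:E)%E.
Proof.
move=> uA; apply/lee_addgt0Pr => e e0.
have M0 := ltW M_gt0; have Me : M < M + e by rewrite ltrDl.
(* The root has order [n.+1] while the bound has exponent [n]; hence the constant [A / M] in front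
   of [M ^+ n.+1]. *)
have [n0 Hn0] := geometric_dominates (A / M) M0 Me.
apply: (@limn_esup_le _ _ _ n0) => n le_n; rewrite -EFinD lee_fin.
have Me0 := ltW (le_lt_trans M0 Me).
rewrite -[leRHS](powR_root n) //; apply: ge0_ler_powR; rewrite ?nnegrE ?exprn_ge0 ?invr_ge0 //.
apply: le_trans (uA n) _; apply: le_trans (Hn0 n.+1 (leqW le_n)).
by rewrite exprS mulrA divfK // gt_eqF.
Qed.

Lemma limn_esup_root_ge c n0 : 0 < c -> (forall n, (n0 <= n)%N -> c * M ^+ n <= u n) ->
  (M%:E <= limn_esup (fun n => (u n `^ (n.+1%:R^-1))%:E))%E.
Proof.
move=> c0 uc; apply/lee_subgt0Pr => e e0; rewrite -EFinB.
have [Me0 | Me0] := leP (M - e) 0.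
  apply: (@limn_esup_ge _ _ _ 0) => n _.
  by rewrite lee_fin (le_trans Me0) ?powR_ge0.
have MeM : M - e < M by rewrite ltrBlDr ltrDl.
have [n1 Hn1] := geometric_dominates (M / c) (ltW Me0) MeM.
apply: (@limn_esup_ge _ _ _ (maxn n0 n1)) => n; rewrite geq_max => /andP[le_n0 le_n1].
rewrite lee_fin -[leLHS](powR_root n) ?(ltW Me0) //.
apply: ge0_ler_powR; rewrite ?nnegrE ?exprn_ge0 ?invr_ge0 ?(ltW Me0) //.
apply: le_trans (uc n le_n0); rewrite -(ler_pM2l (divr_gt0 M_gt0 c0)).
apply: le_trans (Hn1 n.+1 (leqW le_n1)) _.
by rewrite exprS mulrA divfK // gt_eqF.
Qed.

End RootGrowth.

Lemma normc_root1 (R : realType) (z : R[i]) n : (0 < n)%N -> z ^+ n = 1 -> Normc.normc z = 1.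
Proof.
move=> n_gt0 zn; have z0 : 0 <= Normc.normc z by case: (z) => a b; apply: sqrtr_ge0.
have : Normc.normc z ^+ n = 1.
  rewrite -(Normc.normc1 R) -[X in _ = Normc.normc X]zn.
  by elim: (n) => [|k IH]; rewrite ?expr0 ?Normc.normc1 // !exprS Normc.normcM IH.
by move/eqP; rewrite pexpr_eq1 // => /eqP.
Qed.

Lemma Cyclotomic_dvd_Xn_sub1 (F : fieldType) n : (0 < n)%N ->
  map_poly intr 'Phi_n %| ('X^n - 1 : {poly F}).
Proof.
move=> n_gt0; have -> : 'X^n - 1 = map_poly intr ('X^n - 1 : {poly int}) :> {poly F}.
  by rewrite rmorphB rmorph1 /= map_polyXn.
rewrite -prod_Cyclotomic // rmorph_prod (big_rem n) /= ?dvdp_mulr //.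
by rewrite -dvdn_divisors.
Qed.

Section GrowthRates.
Variables (R : realType) (p : {poly int}) (s : seq nat) (a : nat -> nat).
Hypotheses (mon_p : p \is monic) (s_gt0 : all (fun n => 0 < n)%N s).
Let Psi : {poly int} := \prod_(n <- s) 'Phi_n.
Let q : {poly int} := p * Psi.
Hypothesis sep_q : separable_poly (map_poly intr q : {poly rat}).
Hypothesis ann_q : annihilates (map_poly intr q) (fun n => (a n)%:R : rat).
Hypothesis min_q : forall r : {poly rat},
  annihilates r (fun n => (a n)%:R) -> map_poly intr q %| r.

Let mon_Psi : Psi \is monic.
Proof. by apply: monic_prod => n _; apply: Cyclotomic_monic. Qed.
Let mon_q : q \is monic. Proof. by rewrite monicMl. Qed.

Lemma min_poly_ext (K : numFieldType) (r : {poly K}) :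
    r \is monic -> annihilates r (fun n => (a n)%:R) ->
  (size (map_poly intr q : {poly K}) <= size r)%N.
Proof.
move=> mon_r ann_r; rewrite -map_poly_ratr_intr size_map_poly.
apply: (annihilator_size (f := ratr) (monic_map _ mon_q) ann_q min_q mon_r).
by move=> n; rewrite -[RHS](ann_r n); apply: act_ext => k; rewrite /= ratr_nat.
Qed.

Lemma ann_ext (K : numFieldType) :
  annihilates (map_poly intr q : {poly K}) (fun n => (a n)%:R).
Proof.
move=> n; rewrite -map_poly_ratr_intr -(rmorph0 (ratr : rat -> K)) -(ann_q n) -act_map.
by apply: act_ext => k; rewrite /= ratr_nat.
Qed.

(** The roots of [q] are simple and occur in [a] with nonzero coefficients, so the Hankel bounds
    apply. The roots of [Psi] have modulus 1 and leave the product of the maxima equal to the Mahler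
    measure of [p]. *)
Lemma GR_Mahler : (forall k, (GR R a k <= (Mahler R p)%:E)%E) /\
  (exists k, GR R a k = (Mahler R p)%:E).
Proof.
pose f0 : {poly R[i]} := map_poly intr p; pose h0 : {poly R[i]} := map_poly intr Psi.
pose zs := croots f0; pose us := sval (closed_field_poly_normal h0).
have Df0 : f0 = \prod_(z <- zs) ('X - z%:P).
  rewrite /zs /croots; case: closed_field_poly_normal => r /= {1}->.
  by rewrite (monicP _) ?scale1r // monic_map.
have Dh0 : h0 = \prod_(z <- us) ('X - z%:P).
  rewrite /us; case: closed_field_poly_normal => r /= {1}->.
  by rewrite (monicP _) ?scale1r // monic_map.
pose rs := zs ++ us.
have Dq : map_poly intr q = \prod_(z <- rs) ('X - z%:P).
  by rewrite big_cat /= -Df0 -Dh0 rmorphM.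
have uniq_rs : uniq rs.
  by rewrite -separable_prod_XsubC -Dq -map_poly_ratr_intr separable_map.
have norm_us z : z \in us -> Normc.normc z = 1.
  move=> z_us; have : root h0 z by rewrite Dh0 root_prod_XsubC.
  rewrite /h0 rmorph_prod /= /root horner_prod => /eqP/eqP; rewrite prodf_seq_eq0.
  case/hasP => n n_s /= Pz; have n_gt0 := allP s_gt0 n n_s.
  apply: (@normc_root1 _ _ n) => //.
  have : root ('X^n - 1) z by apply: root_dvdp (Cyclotomic_dvd_Xn_sub1 _ n_gt0) Pz.
  by rewrite /root !hornerE subr_eq0 => /eqP.
have ann_rs : annihilates (\prod_(z <- rs) ('X - z%:P)) (fun n => (a n)%:R : R[i]).
  by rewrite -Dq; apply: ann_ext.
have [c Da] := exponential_sum uniq_rs ann_rs.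
have c_neq0 : forall z, z \in rs -> c z != 0.
  apply: (exponential_sum_neq0 uniq_rs Da) => r mon_r ann_r.
  by rewrite -ltnS -(size_prod_XsubC rs id) -Dq; apply: min_poly_ext.
pose D := size rs; pose x (d : 'I_D) := rs`_d; pose g (d : 'I_D) := c rs`_d.
have x_inj : injective x.
  by move=> d e /eqP; rewrite nth_uniq // => /eqP/val_inj.
have g_neq0 d : g d != 0 by rewrite c_neq0 ?mem_nth.
have DM : \prod_d Num.max (Normc.normc (x d)) 1 = Mahler R p.
  rewrite /Mahler (monicP mon_p) normr1 mul1r.
  transitivity (\prod_(z <- rs) Num.max (Normc.normc z) 1).
    by rewrite (big_nth 0) big_mkord.
  rewrite big_cat /= [X in _ * X]big1_seq ?mulr1 // => z /andP[_ /norm_us ->].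
  by rewrite maxxx.
pose u k n : R := `|\det (\matrix_(i < k, j < k) ((a (n + i + j)%N)%:R : R))|.
have Du k n : u k n = Normc.normc (\det (hankel g x k n)).
  have -> : hankel g x k n = map_mx (real_complex R)
      (\matrix_(i < k, j < k) ((a (n + i + j)%N)%:R : R)).
    apply/matrixP => i j; rewrite !mxE rmorph_nat Da (big_nth 0) big_mkord.
    by apply: eq_bigr => d _.
  by rewrite det_map_mx /u /= expr0n /= addr0 sqrtr_sqr.
have u_ge0 k n : 0 <= u k n by rewrite normr_ge0.
set M := Mahler R p in DM *.
have M_ge1 : 1 <= M.
  by rewrite -DM; elim/big_ind: _ => [//|b b' b1 b1'|d _]; rewrite ?mulr_ege1 // le_max lexx orbT.
have M_gt0 : 0 < M by apply: lt_le_trans M_ge1.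
have GR_le k : (GR R a k <= M%:E)%E.
  case: k => [|k] /=; first by rewrite lee_fin.
  have [A HA] := det_hankel_le g x k.+1.
  by apply: (@limn_esup_root_le _ (u k.+1) _ _ M_gt0 A) => // n; rewrite Du -DM.
split=> //; have [k [b [n0 [b0 Hb]]]] := det_hankel_ge x_inj g_neq0.
exists k; apply/eqP; rewrite eq_le GR_le /=; rewrite DM in Hb.
(* [GR] at [k = 0] is 1 by definition. The empty determinant being 1, the lower bound
   [b * M ^+ n <= 1] excludes [M > 1]. *)
case: k Hb => [|k] Hb /=.
  rewrite lee_fin leNgt; apply/negP => M_gt1.
  have [n1 Hn1] := geometric_dominates (2 / b) ler01 M_gt1.
  have := Hn1 _ (leq_maxr n0 n1); have := Hb _ (leq_maxl n0 n1).
  rewrite det_mx00 Normc.normc1 expr1n mulr1 ler_pdivrMr // => H1 H2.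
  by have := le_trans H2; rewrite mulrC => /(_ _ H1); rewrite leNgt ltr1n.
by apply: (@limn_esup_root_ge _ (u k.+1) _ _ M_gt0 b n0) => // n le_n; rewrite Du Hb.
Qed.

End GrowthRates.

(** * Interpolation and integer parts *)

Section Lagrange.
Variables (K : fieldType) (zs : seq K).
Hypothesis uniq_zs : uniq zs.

Definition cofactor_poly (z : K) : {poly K} := \prod_(w <- rem z zs) ('X - w%:P).

Lemma cofactor_poly_neq0 z : z \in zs -> (cofactor_poly z).[z] != 0.
Proof.
move=> z_zs; rewrite -[_ == 0]/(root _ z) root_prod_XsubC mem_rem_uniq // inE eqxx.
by [].
Qed.

Lemma size_cofactor_poly z : z \in zs -> size (cofactor_poly z) = size zs.
Proof.
move=> z_zs; rewrite size_prod_XsubC size_rem // prednK //.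
by case: (zs) z_zs.
Qed.

Lemma deriv_prod_XsubC z : z \in zs ->
  (\prod_(w <- zs) ('X - w%:P))^`().[z] = (cofactor_poly z).[z].
Proof.
move=> z_zs; rewrite (big_rem z) //= derivM derivXsubC mul1r hornerD hornerM.
by rewrite hornerXsubC subrr mul0r addr0.
Qed.

Lemma interpolation (f : {poly K}) : (size f <= size zs)%N ->
  f = \sum_(z <- zs) (f.[z] / (cofactor_poly z).[z]) *: cofactor_poly z.
Proof.
move=> sz_f; apply/eqP; rewrite -subr_eq0; apply/eqP.
apply: (@roots_geq_poly_eq0 _ _ zs) => //; last first.
  rewrite (leq_trans (size_polyD _ _)) // geq_max sz_f size_polyN.
  rewrite big_seq; apply: (leq_trans (size_sum _ _ _)); apply/bigmax_leqP_seq => z _ z_zs.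
  by rewrite (leq_trans (size_scale_leq _ _)) // size_cofactor_poly.
apply/allP => w w_zs; rewrite /root hornerD hornerN horner_sum (big_rem w) //=.
rewrite hornerZ divfK ?cofactor_poly_neq0 // big1_seq ?addr0 ?subrr // => z /andP[_ z_rem].
have : root (cofactor_poly z) w; last by rewrite hornerZ => /rootP ->; rewrite mulr0.
move: z_rem; rewrite root_prod_XsubC !mem_rem_uniq // !inE eq_sym => /andP[-> _].
by rewrite w_zs.
Qed.

End Lagrange.

Lemma int_poly_box d (B : nat) : exists l : seq {poly int},
  forall u : {poly int}, (size u <= d)%N -> (forall i, `|u`_i| <= B%:Z) -> u \in l.
Proof.
elim: d => [|d [l Hl]].
  exists [:: 0] => u; rewrite leqn0 size_poly_eq0 => /eqP -> _.
  by rewrite inE.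
pose cs : seq int := [seq i%:Z | i <- iota 0 B.+1] ++ [seq - i%:Z | i <- iota 0 B.+1].
exists [seq c%:P + v * 'X | c <- cs, v <- l] => u sz_u Bu.
have Du : u = (u`_0)%:P + (\poly_(i < d) u`_i.+1) * 'X.
  apply/polyP => -[|i]; rewrite coefD coefC coefMX /= ?addr0 // add0r coef_poly.
  by case: ltnP => // le_di; rewrite nth_default // (leq_trans sz_u).
rewrite Du; apply: allpairs_f.
  have := Bu 0%N; rewrite mem_cat; case: (u`_0) => n le_nB; apply/orP.
    by left; apply/mapP; exists n => //; rewrite mem_iota; lia.
  by right; apply/mapP; exists n.+1; rewrite ?NegzE // mem_iota; lia.
apply: Hl => [|i]; first exact: size_poly.
by rewrite coef_poly; case: ifP => _; [exact: Bu | rewrite normr0].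
Qed.

Section Floor.
Variable k : nat.
Hypothesis k_gt0 : (0 < k)%N.

Lemma hermite (x : int) : \sum_(j < k) ((x + j%:Z) %/ k%:Z)%Z = x.
Proof.
have k0 : k%:Z != 0 by rewrite eqz_nat -lt0n.
have [r Dr] : exists r : nat, (x %% k)%Z = r%:Z.
  by exists `|(x %% k)%Z|%N; rewrite gez0_abs // modz_ge0.
have rk : (r < k)%N by rewrite -ltz_nat -Dr ltz_pmod.
rewrite {1}(divz_eq x k) Dr.
under eq_bigr => j _ do rewrite -addrA divzMDl // -PoszD divz_nat.
rewrite big_split /= sumr_const card_ord.
have -> : \sum_(j < k) ((r + j) %/ k)%N%:Z = r%:Z.
  rewrite -(big_morph Posz PoszD (erefl _)); congr Posz.
  (* Replacing [r] by [r + 1] shifts the window of summation: [r %/ k] leaves and [(r + k) %/ k],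
     larger by one, enters. *)
  elim: r {Dr rk} => [|r IH]; first by rewrite big1 // => j _; rewrite add0n divn_small.
  apply: (@addnI (r %/ k)%N).
  have := @big_ord_recl _ 0%N addn k (fun j => (r + j) %/ k)%N.
  rewrite big_ord_recr /= addn0 => E.
  have -> : (r %/ k + r.+1 = \sum_(j < k) (r + j) %/ k + (r + k) %/ k)%N.
    by rewrite IH divnDr // divnn k_gt0; lia.
  by rewrite E; congr (_ + _)%N; apply: eq_bigr => j _; rewrite addSnnS.
by rewrite -Dr -mulr_natr natz -divz_eq.
Qed.

Lemma floor_error (x : int) (j : nat) : (j < k)%N ->
  `|k%:Z * ((x + j%:Z) %/ k%:Z)%Z - x| <= k%:Z - 1.
Proof.
move=> jk; have := divz_eq (x + j%:Z) k%:Z.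
have := @modz_ge0 (x + j%:Z) k%:Z; have := @ltz_pmod (x + j%:Z) k%:Z.
rewrite ltz_nat k_gt0 eqz_nat -lt0n k_gt0 => /(_ isT) + /(_ isT).
move: (_ %% _)%Z (_ %/ _)%Z => r q r1 r2 E.
have -> : k%:Z * q - x = j%:Z - r by rewrite mulrC; lia.
by rewrite ler_norml; lia.
Qed.

End Floor.

(** * The linear system *)

Definition ev (z : algC) (u : {poly int}) : algC := (map_poly intr u).[z].

Lemma ev_is_additive z : zmod_morphism (ev z).
Proof. by move=> u v; rewrite /ev rmorphB hornerD hornerN. Qed.
HB.instance Definition _ z := GRing.isZmodMorphism.Build _ _ (ev z) (ev_is_additive z).

Lemma evM z u v : ev z (u * v) = ev z u * ev z v.
Proof. by rewrite /ev rmorphM hornerM. Qed.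

Section Companion.
Variables (p : {poly int}) (zs : seq algC).
Hypothesis mon_p : p \is monic.
Hypothesis Dp : map_poly intr p = \prod_(z <- zs) ('X - z%:P) :> {poly algC}.
Hypothesis uniq_zs : uniq zs.
Hypothesis zs_gt0 : (0 < size zs)%N.
Let d := size zs.

Lemma size_minpoly : size p = d.+1.
Proof.
by rewrite -(size_prod_XsubC zs id) -Dp size_map_poly_id0 // (monicP mon_p) oner_neq0.
Qed.

Lemma ev_root z : z \in zs -> ev z p = 0.
Proof. by move=> z_zs; apply/eqP; rewrite /ev Dp -/(root _ z) root_prod_XsubC. Qed.

(** Multiplication by t in Z[t]/(p) on representatives of size at most [d]; as [p] is monic,
    subtracting the top coefficient times [p] cancels the new leading term. *)
Definition mulX (u : {poly int}) : {poly int} := 'X * u - (u`_d.-1)%:P * p.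

Lemma mulX_is_additive : zmod_morphism mulX.
Proof. by move=> u v; rewrite /mulX coefB polyCB; ring. Qed.
HB.instance Definition _ := GRing.isZmodMorphism.Build _ _ mulX mulX_is_additive.

Lemma mulX_size (u : {poly int}) : (size u <= d)%N -> (size (mulX u) <= d)%N.
Proof.
move=> sz_u; apply/leq_sizeP => i le_di; rewrite coefB coefXM coefCM.
case: i le_di => [|i]; first by rewrite leqNgt zs_gt0.
rewrite leq_eqVlt => /predU1P[Di | lt_di] /=.
  have -> : p`_i.+1 = 1 by rewrite -Di -(monicP mon_p) lead_coefE size_minpoly.
  by rewrite mulr1 Di subrr.
have -> : p`_i.+1 = 0 by rewrite nth_default ?size_minpoly.
by rewrite mulr0 subr0 nth_default // (leq_trans sz_u).
Qed.

Lemma ev_mulX z u : z \in zs -> ev z (mulX u) = z * ev z u.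
Proof.
move=> z_zs; rewrite /mulX raddfB /= !evM ev_root // mulr0 subr0.
by rewrite /ev map_polyX hornerX.
Qed.

Lemma ev_iter_mulX z u n : z \in zs -> ev z (iter n mulX u) = z ^+ n * ev z u.
Proof.
by move=> z_zs; elim: n => [|n IH] /=; rewrite ?mul1r // ev_mulX // IH exprS mulrA.
Qed.

(* The trace of multiplication by t^m u in Q[t]/(p), by Euler's formula:
   Tr(f / p') is the coefficient of degree d-1 of the remainder of f mod p. *)
Definition tr m (u : {poly int}) : int :=
  (Pdiv.Ring.rmodp ('X^m * u * p^`()) p)`_d.-1.

(** The remainder takes the value z^m u(z) p'(z) at each root z, and Lagrange's formula divides by
    p'(z). The cofactors are monic of degree d - 1, so the coefficient of that degree is the sum of
    the quotients. *)
Lemma trE m u : (tr m u)%:~R = \sum_(z <- zs) z ^+ m * ev z u.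
Proof.
set f := 'X^m * u * p^`(); pose w := Pdiv.Ring.rmodp f p.
have sz_w : (size w <= d)%N.
  by rewrite -ltnS -size_minpoly Pdiv.Ring.ltn_rmodpN0 // monic_neq0.
have ev_w z : z \in zs -> ev z w = z ^+ m * ev z u * (cofactor_poly zs z).[z].
  move=> z_zs; have -> : ev z w = ev z f.
    by rewrite [in RHS](Pdiv.RingMonic.rdivp_eq mon_p f) raddfD /= evM ev_root // mulr0 add0r.
  rewrite /f !evM {1}/ev map_polyXn hornerXn; congr (_ * _).
  by rewrite /ev -deriv_map Dp deriv_prod_XsubC.
rewrite /tr -/w -coef_map.
have sz_wC : (size (map_poly intr w : {poly algC}) <= size zs)%N.
  by rewrite (leq_trans (size_poly _ _)).
rewrite (interpolation uniq_zs sz_wC) coef_sum; apply: eq_big_seq => z z_zs.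
rewrite coefZ -/(ev z w) ev_w //.
rewrite mulfK ?cofactor_poly_neq0 //.
have -> : (cofactor_poly zs z)`_d.-1 = 1.
  by rewrite -(monicP (monic_prod_XsubC (rem z zs) xpredT id)) lead_coefE size_cofactor_poly.
by rewrite mulr1.
Qed.

Lemma trB m : {morph tr m : u v / u - v}.
Proof.
move=> u v; apply: (@intr_inj algC); rewrite rmorphB /= !trE -sumrB.
by apply: eq_bigr => z _; rewrite raddfB mulrBr.
Qed.

Variables (N m : nat).
Hypothesis N_gt0 : (0 < N)%N.
(* Both components are coefficient vectors, of lengths [deg p] and [N]. *)
Definition state := ({poly int} * {poly int})%type.
Implicit Type s : state.

(** Index [N] stands for the value that [step] appends; thus the conditions on a state can also
    constrain its next entry. *)
Definition entry s i : int := if (i < N)%N then s.2`_i else s.2`_0 + tr m s.1.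

Definition step s : state := (mulX s.1, \poly_(i < N) entry s i.+1).

Lemma entryB s t i : entry (s - t) i = entry s i - entry t i.
Proof. by rewrite /entry /= !coefB trB; case: ifP => // _; ring. Qed.

Lemma step_is_additive : zmod_morphism step.
Proof.
move=> s t; rewrite /step [LHS]surjective_pairing [RHS]surjective_pairing /=.
congr pair; first exact: raddfB.
by apply/polyP => i; rewrite coefB !coef_poly entryB; case: ifP; rewrite ?subr0.
Qed.
HB.instance Definition _ := GRing.isZmodMorphism.Build _ _ step step_is_additive.

Definition len s n : int := (iter n step s).2`_0.

Lemma lenS s n : len s n.+1 = len (step s) n.
Proof. by rewrite /len iterSr. Qed.

Lemma len_sum I (r : seq I) (F : I -> state) n :
  len (\sum_(i <- r) F i) n = \sum_(i <- r) len (F i) n.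
Proof.
elim: n F => [|n IH] F; last first.
  by rewrite lenS raddf_sum IH; apply: eq_bigr => i _; rewrite lenS.
rewrite /len /=; elim/big_ind2: _ => [|s i t j <- <-|//]; first by rewrite coef0.
by rewrite coefD.
Qed.

Lemma len_entry s i : (i <= N)%N -> len s i = entry s i.
Proof.
elim: i s => [|i IH] s le_iN; first by rewrite /entry N_gt0.
by rewrite lenS IH 1?ltnW // {1}/entry le_iN /= coef_poly le_iN.
Qed.

Lemma iter_step_fst s n : (iter n step s).1 = iter n mulX s.1.
Proof. by elim: n => //= n ->. Qed.

Lemma len_addN s n : len s (n + N) = len s n + tr m (iter n mulX s.1).
Proof.
rewrite /len addnC iterD -/(len _ N) len_entry // /entry ltnn.
by rewrite iter_step_fst.
Qed.

(** By [len_addN], ['X^N - 1] turns the heights into traces. These are combinations of powers of the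
    roots of [p], hence killed by [p]. *)
Lemma len_annihilated s :
  annihilates (map_poly intr (p * ('X^N - 1))) (fun n => (len s n)%:~R : rat).
Proof.
move=> n; apply: (fmorph_inj (ratr : rat -> algC)); rewrite rmorph0 -act_map.
rewrite map_poly_ratr_intr rmorphM rmorphB rmorph1 /= map_polyXn.
rewrite actM (@act_ext _ _ _ (fun n => \sum_(z <- zs) (z ^+ m * ev z s.1) * z ^+ n)); last first.
  move=> l; rewrite actD act_Xn -polyC1 -polyCN actC mulN1r /= !rmorph_int -rmorphB /=.
  rewrite len_addN addrAC subrr add0r trE; apply: eq_big_seq => z z_zs.
  by rewrite ev_iter_mulX // mulrCA mulrC -mulrA mulrC -mulrA.
rewrite /act; under eq_bigr do rewrite big_distrr /=.
rewrite exchange_big /= big1_seq // => z /andP[_ z_zs].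
under eq_bigr => j _ do rewrite mulrCA.
rewrite -big_distrr /= -/(act (map_poly intr p) (fun k => z ^+ k) n) act_geometric.
by rewrite -/(ev z p) ev_root // mul0r mulr0.
Qed.

Definition piece (k : nat) s (j : nat) : state :=
  (\poly_(i < d) ((s.1`_i + j%:Z) %/ k%:Z)%Z, \poly_(i < N) ((s.2`_i + j%:Z) %/ k%:Z)%Z).

Lemma sum_piece k s : (0 < k)%N -> (size s.1 <= d)%N -> (size s.2 <= N)%N ->
  \sum_(j < k) piece k s j = s.
Proof.
move=> k_gt0 sz1 sz2; rewrite [LHS]surjective_pairing [RHS]surjective_pairing.
have Q n (u : {poly int}) : (size u <= n)%N ->
    \sum_(j < k) \poly_(i < n) ((u`_i + j%:Z) %/ k%:Z)%Z = u.
  move=> sz_u; apply/polyP => i; rewrite coef_sum.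
  under eq_bigr => j _ do rewrite coef_poly.
  case: ltnP => [lt_in | le_ni]; first exact: hermite.
  by rewrite big1 // nth_default // (leq_trans sz_u).
congr pair.
  by rewrite -[RHS](Q _ _ sz1); elim/big_rec2: _ => [|j x y _ <-].
by rewrite -[RHS](Q _ _ sz2); elim/big_rec2: _ => [|j x y _ <-].
Qed.

End Companion.

(** * The invariant *)

(** In the application [A] is entry i + 1 and [c] is l^i, while [A'] and [x'] arise by dividing [A]
    and [l * x] by [k] with rounding. The rounding of [A] costs [(k - 1) * X], which with the old
    slack [X] gives just [k * X]. The rounding of [x'] costs at most 3/2 of [c * k * r], because
    [e <= 1 / 2], and the increase [t] of the tolerance pays for it. *)
Lemma band_step (F : realFieldType) (k A A' X c l x x' r e t : F) :
    1 <= k -> 0 <= c -> 0 < X -> `|k * A' - A| <= k - 1 ->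
    `|A * X - c * l * x| <= e * (c * l * x) + X -> `|k * x' - l * x| <= k * r ->
    0 <= e -> e <= 1 / 2 -> 3 / 2 * r <= t * x' ->
  `|A' * X - c * x'| <= (e + t) * (c * x') + X.
Proof.
move=> k1 c0 X0 Hf Hb Hx e0 e2 Ht; have k0 : 0 < k by apply: lt_le_trans k1.
rewrite -(ler_pM2l k0) -{1}(gtr0_norm k0) -normrM.
have H1 : `|(k * A' - A) * X| <= (k - 1) * X by rewrite normrM (gtr0_norm X0) ler_pM2r.
have H2 : `|c * (k * x' - l * x)| <= c * (k * r) by rewrite normrM (ger0_norm c0) ler_wpM2l.
have ck : 0 <= c * k by rewrite mulr_ge0 // ltW.
have H3 := ler_wpM2l ck Ht.
have H4 : e * (c * l * x) <= e * (c * (k * x') + c * (k * r)).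
  by rewrite ler_wpM2l //; move: H2; rewrite ler_norml => /andP[H _]; lra.
have H5 : e * (c * (k * r)) <= 1 / 2 * (c * (k * r)).
  by apply: ler_wpM2r => //; rewrite mulr_ge0 // (le_trans _ Hx).
rewrite (_ : k * (A' * X - c * x') =
  (k * A' - A) * X + (A * X - c * l * x) - c * (k * x' - l * x)); last by ring.
apply: le_trans (ler_normB _ _) _; apply: le_trans (lerD (ler_normD _ _) (lexx _)) _.
apply: le_trans (lerD (lerD H1 Hb) H2) _.
rewrite (_ : k * ((e + t) * (c * x') + X) = e * (c * (k * x')) + c * k * (t * x') + k * X);
  last by ring.
by lra.
Qed.

Lemma floor_succ_le (k j : nat) (x y : int) : (j < k)%N -> x <= k%:Z * y ->
  ((1 + x + j%:Z) %/ k%:Z)%Z <= 1 + y.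
Proof.
move=> jk xy; have k0 : 0 < k%:Z by rewrite ltz_nat; case: (k) jk.
have := divz_eq (1 + x + j%:Z) k%:Z; have := @modz_ge0 (1 + x + j%:Z) k%:Z.
rewrite gt_eqF // => /(_ isT); move: (_ %% _)%Z (_ %/ _)%Z => r q r0 E.
rewrite -ltzD1 -(ltr_pM2r k0) !mulrDl !mul1r [y * _]mulrC.
by move: (k%:Z * y) (q * k%:Z) E xy => ky qk; lia.
Qed.

Definition nrm (z : algC) : algR := in_algR (normr_real z).

Lemma nrm_ge0 z : 0 <= nrm z. Proof. exact: normr_ge0. Qed.
Lemma nrmD y z : nrm (y + z) <= nrm y + nrm z. Proof. exact: ler_normD. Qed.
Lemma nrmM y z : nrm (y * z) = nrm y * nrm z.
Proof. by apply: val_inj; rewrite /= normrM. Qed.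
Lemma nrmX z n : nrm (z ^+ n) = nrm z ^+ n.
Proof. by apply: val_inj; rewrite /= rmorphXn /= normrX. Qed.
Lemma nrm_algR (x : algR) : nrm (algRval x) = `|x|.
Proof. exact: val_inj. Qed.
Lemma nrm_int (n : int) : nrm n%:~R = `|n|%:~R.
Proof. by rewrite -(rmorph_int algRval) nrm_algR -intr_norm. Qed.
Lemma nrm_sum I (r : seq I) (P : pred I) (F : I -> algC) :
  nrm (\sum_(i <- r | P i) F i) <= \sum_(i <- r | P i) nrm (F i).
Proof.
elim/big_ind2: _ => [|a b c d ab cd|//].
  by rewrite -(rmorph0 algRval) nrm_algR normr0.
by apply: le_trans (nrmD _ _) (lerD ab cd).
Qed.

Definition evr (l : algR) (u : {poly int}) : algR := (map_poly intr u).[l].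

Lemma evrE l u : algRval (evr l u) = ev (algRval l) u.
Proof.
rewrite /evr /ev -horner_map /= -map_poly_comp; congr (_.[_]).
by apply: eq_map_poly => c /=; rewrite rmorph_int.
Qed.

Lemma ev_bound (d : nat) (l : algR) (z : algC) (k : int) (f : {poly int}) :
    nrm z <= l -> (size f <= d)%N -> (forall i, `|f`_i| <= k) ->
  nrm (ev z f) <= k%:~R * \sum_(i < d) l ^+ i.
Proof.
move=> zl sz_f fk; rewrite /ev (@horner_coef_wide _ d); last first.
  exact: leq_trans (size_poly _ _) sz_f.
apply: le_trans (nrm_sum _ _ _) _; rewrite big_distrr /=; apply: ler_sum => i _.
rewrite coef_map /= nrmM nrmX nrm_int ler_pM ?exprn_ge0 ?nrm_ge0 ?ler0z ?ler_int //.
by rewrite lerXn2r ?nnegrE ?nrm_ge0 ?(le_trans (nrm_ge0 _) zl).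
Qed.

Section Invariant.
Variables (p : {poly int}) (lam nu : algR) (zs : seq algC).
Let roots := algRval lam :: zs.
Hypothesis mon_p : p \is monic.
Hypothesis Dp : map_poly intr p = \prod_(z <- roots) ('X - z%:P) :> {poly algC}.
Hypothesis uniq_roots : uniq roots.
Hypothesis lam_gt1 : 1 < lam.
Hypothesis nu_lt : nu < lam.
Hypothesis nu_ge0 : 0 <= nu.
Hypothesis zs_nu : forall z, z \in zs -> nrm z <= nu.
Let d := size roots.
(** Rounding changes each of the [d] coefficients of u by less than 1, so this bounds the change of
    u(z) for |z| <= lam. *)
Let r : algR := \sum_(i < d) lam ^+ i.
(** Small enough for [del_lam]: the relative errors of two traces and of one rounding are outweighed
    by one factor [lam]. *)
Let del : algR := (lam - 1) / (4 * lam).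
Variables (m n : nat).
Let N := (m + n)%N.
Let X := lam ^+ n.
(** The loss [3 / 2 * r] of [band_step] relative to the lower bound [X / 8] on u(lam). *)
Let th := 12 * r / X.
(** [Hm] limits the share of the other roots in a trace, and [HN] says that [N] increments [th] add
    up to at most 1/4. [Hdel] and [Hgap] keep the rounding small against the relative error [del]
    and against the gap between [nu] and [lam]. *)
Hypothesis Hm : (size zs)%:R * nu ^+ m <= del * lam ^+ m.
Hypothesis HN : 48 * N%:R * r <= X.
Hypothesis Hdel : 8 * r <= del * X.
Hypothesis Hgap : 16 * r * lam <= (lam - nu) * X.

Local Notation x := (evr lam).
Local Notation mulX := (mulX p roots).
Local Notation tr := (tr p roots m).
Local Notation entry := (entry p roots N m).
Local Notation step := (step p roots N m).
Local Notation piece := (piece roots N).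
Implicit Types (s : state) (u : {poly int}).

Let lam_gt0 : 0 < lam. Proof. exact: lt_trans lam_gt1. Qed.
Let X_gt0 : 0 < X. Proof. exact: exprn_gt0. Qed.
Let d_gt0 : (0 < d)%N. Proof. by []. Qed.
Let r_ge1 : 1 <= r.
Proof.
rewrite /r big_ord_recl expr0 lerDl sumr_ge0 // => i _.
by rewrite exprn_ge0 // ltW.
Qed.
Let del_gt0 : 0 < del. Proof. by rewrite divr_gt0 ?subr_gt0 // mulr_gt0. Qed.
Let del_lt : del <= 1 / 4.
Proof. by rewrite ler_pdivrMr ?mulr_gt0 //; lra. Qed.
Let del_lam : 1 + del <= (1 - del) * (lam * (1 - del)).
Proof.
have E : del * (4 * lam) = lam - 1 by rewrite divfK // gt_eqF // mulr_gt0.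
have L1 : 0 <= lam * del ^+ 2 by rewrite mulr_ge0 ?sqr_ge0 // ltW.
have L2 : del <= del * lam by rewrite ler_peMr // ltW.
rewrite -subr_ge0 (_ : _ - _ = (lam - 1) - 2 * (del * lam) - del + lam * del ^+ 2); last by ring.
by move: E L1 L2 lam_gt1; generalize del => e; lra.
Qed.
Lemma period_gt0 : (0 < N)%N.
Proof.
case: (posnP N) => // N0; have n0 : n = 0%N by move/eqP: N0; rewrite /N addn_eq0 => /andP[_ /eqP].
by have := Hdel; rewrite /X n0 expr0 mulr1; have := del_lt; have := r_ge1; lra.
Qed.
Let N_gt0 := period_gt0.
Let th_ge0 : 0 <= th.
Proof. by rewrite divr_ge0 ?(ltW X_gt0) // mulr_ge0 // (le_trans ler01 r_ge1). Qed.
(** Each step moves an entry down by one index, so allowing [th] more at each lower index leaves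
    room for one rounding per step. A new entry at index [N] starts with the trace error [del]. *)
Let eps i : algR := del + (N - i)%:R * th.
Let eps_ge0 i : 0 <= eps i.
Proof. exact: addr_ge0 (ltW del_gt0) (mulr_ge0 (ler0n _ _) th_ge0). Qed.
Let eps_le i : eps i <= 1 / 2.
Proof.
have : (N - i)%:R * th <= N%:R * th by rewrite ler_wpM2r // ler_nat leq_subr.
have : N%:R * th <= 1 / 4.
  by rewrite /th mulrA ler_pdivrMr // ; move: HN; lra.
by have := del_lt; rewrite /eps; lra.
Qed.
Let epsS i : (i < N)%N -> eps i = eps i.+1 + th.
Proof.
by move=> iN; rewrite /eps -subSS subSn // -natr1; ring.
Qed.
Let lamN : lam ^+ N = lam ^+ m * X. Proof. by rewrite /N exprD. Qed.
Let band_last (t : int) y : `|t%:~R - lam ^+ m * y| <= del * (lam ^+ m * y) ->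
  `|(1 + t)%:~R * X - lam ^+ N * y| <= eps N * (lam ^+ N * y) + X.
Proof.
move=> ty; rewrite lamN /eps subnn mul0r addr0 mulrAC.
have H : `|(t%:~R - lam ^+ m * y) * X| <= del * (lam ^+ m * y) * X.
  by rewrite normrM (gtr0_norm X_gt0) ler_pM2r ?X_gt0.
rewrite rmorphD /= (_ : _ - _ = X + (t%:~R - lam ^+ m * y) * X); last by rewrite mulr1z; ring.
by apply: le_trans (ler_normD _ _) _; rewrite (gtr0_norm X_gt0) addrC mulrA lerD2r.
Qed.
Let r_X : 8 * r <= X.
Proof.
apply: le_trans Hdel _; apply: le_trans (_ : 1 / 4 * X <= _); first by rewrite ler_pM2r.
by have := X_gt0; lra.
Qed.

Lemma tr_bound u : 0 <= x u -> (forall z, z \in zs -> nrm (ev z u) <= x u) ->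
  `|(tr u)%:~R - lam ^+ m * x u| <= del * (lam ^+ m * x u).
Proof.
move=> x0 dom; have E : algRval ((tr u)%:~R - lam ^+ m * x u) = \sum_(z <- zs) z ^+ m * ev z u.
  rewrite (rmorphB algRval) (rmorphM algRval) (rmorphXn algRval) (rmorph_int algRval).
  by rewrite [X in _ * X]evrE (trE mon_p Dp uniq_roots) // big_cons addrAC subrr add0r.
rewrite -nrm_algR E.
apply: le_trans (nrm_sum _ _ _) _.
apply: le_trans (_ : (size zs)%:R * nu ^+ m * x u <= _); last first.
  by rewrite [leRHS]mulrA ler_wpM2r.
rewrite (_ : _ * _ * _ = \sum_(z <- zs) nu ^+ m * x u); last first.
  by rewrite big_const_seq count_predT iter_addr_0 -mulrA mulr_natl.
rewrite big_seq [leRHS]big_seq; apply: ler_sum => z z_zs.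
rewrite nrmM nrmX ler_pM ?exprn_ge0 ?nrm_ge0 ?dom //.
by rewrite lerXn2r ?nnegrE ?nrm_ge0 ?zs_nu.
Qed.

Record admissible s : Prop := Admissible {
  adm_size1 : (size s.1 <= d)%N;
  adm_size2 : (size s.2 <= N)%N;
  adm_head : s.2`_0 = 1;
  adm_mono : forall i, (i < N)%N -> entry s i <= entry s i.+1;
  adm_band : forall i, (i <= N)%N ->
    `|(entry s i)%:~R * X - lam ^+ i * x s.1| <= eps i * (lam ^+ i * x s.1) + X;
  adm_low : X / 8 <= x s.1;
  adm_dom : forall z, z \in zs -> nrm (ev z s.1) <= x s.1 }.

Lemma adm_entry_ge1 s i : admissible s -> (i <= N)%N -> 1 <= entry s i.
Proof.
move=> Is; elim: i => [|i IH] le_iN; first by rewrite /entry N_gt0 (adm_head Is).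
exact: le_trans (IH (ltnW le_iN)) (adm_mono Is le_iN).
Qed.

Lemma adm_gt0 s : admissible s -> 0 < x s.1.
Proof. by move=> Is; apply: lt_le_trans (adm_low Is); rewrite divr_gt0. Qed.

(** The band at index 0, where the entry is 1, gives x - X <= x / 2 + X. *)
Lemma adm_upper s : admissible s -> x s.1 <= 4 * X.
Proof.
move=> Is; have := adm_band Is (leq0n N).
rewrite /entry N_gt0 (adm_head Is) mul1r expr0 mul1r ler_norml => /andP[H _].
have := ler_wpM2r (ltW (adm_gt0 Is)) (eps_le 0).
by move: H; have := X_gt0; generalize (eps 0) => e; lra.
Qed.

(** * Preservation of the invariant under splitting *)

Section Preservation.
Variables (s : state) (j : nat).
Hypothesis Is : admissible s.
Let k := `|entry s 1|%N.
Hypothesis jk : (j < k)%N.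
Let s' := piece k (step s) j.
Let w := mulX s.1.
Let kR : algR := k%:R.

Let kE : entry s 1 = k%:Z.
Proof. by rewrite gez0_abs // (le_trans _ (adm_entry_ge1 Is N_gt0)). Qed.
Let k_gt0 : (0 < k)%N. Proof. exact: leq_ltn_trans jk. Qed.
Let kR1 : 1 <= kR. Proof. by rewrite ler1n. Qed.
Let x0 : 0 < x s.1 := adm_gt0 Is.

Let sz_w : (size w <= d)%N.
Proof. exact: (mulX_size mon_p Dp d_gt0 (adm_size1 Is)). Qed.

Let root_lam : algRval lam \in roots. Proof. exact: mem_head. Qed.

Let x_w : x w = lam * x s.1.
Proof.
by apply: val_inj; rewrite /= !evrE (ev_mulX Dp).
Qed.

Let err z : nrm z <= lam -> nrm (k%:R * ev z s'.1 - ev z w) <= kR * r.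
Proof.
move=> z_lam; rewrite mulr_natl -raddfMn -raddfB.
have -> : kR = (k%:Z)%:~R by [].
apply: (ev_bound z_lam) => [|i].
  rewrite (leq_trans (size_polyD _ _)) // geq_max size_polyN sz_w andbT.
  by rewrite -scaler_nat (leq_trans (size_scale_leq _ _)) // size_poly.
rewrite coefB coefMn coef_poly; case: ltnP => [lt_id | le_di].
  rewrite -mulr_natl natz; apply: le_trans (floor_error k_gt0 _ jk) _.
  by rewrite lerBlDr lerDl.
by rewrite mul0rn nth_default ?subrr ?normr0 // (leq_trans sz_w).
Qed.

Let err_x : `|kR * x s'.1 - lam * x s.1| <= kR * r.
Proof.
have := err (z := algRval lam); rewrite nrm_algR ger0_norm ?(ltW lam_gt0) // => /(_ (lexx _)).
rewrite -!evrE -(rmorph_nat algRval) -(rmorphM algRval) -(rmorphB algRval) nrm_algR.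
by rewrite x_w.
Qed.

Let sz1 : (size s'.1 <= d)%N. Proof. exact: size_poly. Qed.
Let sz2 : (size s'.2 <= N)%N. Proof. exact: size_poly. Qed.

Let entry_s' i : (i < N)%N -> entry s' i = ((entry s i.+1 + j%:Z) %/ k%:Z)%Z.
Proof. by move=> iN; rewrite /entry iN /= !coef_poly iN. Qed.

Let head_s' : s'.2`_0 = 1.
Proof.
have := entry_s' N_gt0; rewrite {1}/entry N_gt0 => ->.
by rewrite kE -PoszD divz_nat -{1}[k]mul1n divnMDl // divn_small.
Qed.

(** For [k >= 2] the band at index 1 yields [kR * X <= 3 * (lam * x s.1)], and the rounding costs at
    most [kR * X / 8]. For [k = 1] the division is exact and [x s'.1 = lam * x s.1] exceeds
    [x s.1]. *)
Let kX_le : kR * X <= 8 * (lam * x s.1) /\ X / 8 <= x s'.1.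
Proof.
have X0 := X_gt0; have L1 : x s.1 <= lam * x s.1 by rewrite ler_peMl // ltW.
case: (ltngtP k 1%N) => [|k_gt1|k1]; first by rewrite ltnNge k_gt0.
  have k2 : 2 <= kR by rewrite ler_nat.
  have := adm_band Is N_gt0; rewrite kE expr1 ler_norml => /andP[_ H].
  have := ler_wpM2r (ltW (lt_le_trans x0 L1)) (eps_le 1) => H2.
  have H3 : (kR - 1) * X <= 3 / 2 * (lam * x s.1).
    by move: H H2; rewrite -[(k%:Z)%:~R]/kR; generalize (eps 1) => e; lra.
  have H4 := ler_wpM2r (ltW X0) k2.
  split; first by lra.
  move: err_x; rewrite ler_norml => /andP[H5 _].
  have kr := ler_wpM2l (le_trans ler01 kR1) r_X.
  rewrite -(ler_pM2l (lt_le_trans ltr01 kR1)); lra.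
have j0 : j = 0%N by move: jk; rewrite k1; case: (j).
have -> : x s'.1 = lam * x s.1.
  rewrite -x_w; congr evr; apply/polyP => i.
  rewrite coef_poly j0 k1 addr0 divz1; case: ltnP => // le_di.
  by rewrite nth_default // (leq_trans sz_w).
rewrite /kR k1 mul1r; have := adm_low Is; split; lra.
Qed.

Let low_s' : X / 8 <= x s'.1. Proof. by case: kX_le. Qed.
Let x'0 : 0 < x s'.1. Proof. by apply: lt_le_trans low_s'; rewrite divr_gt0. Qed.

(** Multiplication by t lowers the bound on |u(z)| / u(lam) by the factor [nu / lam]; [Hgap] and
    [low_s'] ensure that rounding does not use up this gain. *)
Let dom_s' z : z \in zs -> nrm (ev z s'.1) <= x s'.1.
Proof.
move=> z_zs; have z_nu := zs_nu z_zs; have k0 := lt_le_trans ltr01 kR1.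
have := err (le_trans z_nu (ltW nu_lt)).
have -> : ev z w = z * ev z s.1 by rewrite (ev_mulX Dp) // inE z_zs orbT.
have H1 : nrm (z * ev z s.1) <= nu * x s.1.
  by rewrite nrmM ler_pM ?nrm_ge0 ?(adm_dom Is).
set y := ev z s'.1 => H2.
have H3 : kR * nrm y <= nu * x s.1 + kR * r.
  have -> : kR * nrm y = nrm (k%:R * y) by rewrite nrmM -(rmorph_nat algRval) nrm_algR normr_nat.
  have := nrmD (z * ev z s.1) (k%:R * y - z * ev z s.1); rewrite addrC subrK; lra.
have H4 : lam * x s.1 <= kR * x s'.1 + kR * r.
  by move: err_x; rewrite ler_norml => /andP[]; lra.
have H5 := ler_wpM2l nu_ge0 H4; have H6 := ler_wpM2l (ltW lam_gt0) H3.
have gap : 0 <= lam - nu by rewrite subr_ge0 ltW.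
have H7 := ler_wpM2l gap low_s'.
have H8 : 2 * (r * lam) <= (lam - nu) * x s'.1 by move: Hgap; lra.
have H9 := ler_wpM2l (ltW k0) H8.
have H10 : nu * (kR * r) <= lam * (kR * r).
  by rewrite ler_wpM2r ?(ltW nu_lt) // mulr_ge0 ?(ltW k0) // (le_trans ler01).
rewrite -(ler_pM2l (mulr_gt0 lam_gt0 k0)); lra.
Qed.

Let tr_s' : `|(tr s'.1)%:~R - lam ^+ m * x s'.1| <= del * (lam ^+ m * x s'.1).
Proof. exact: tr_bound (ltW x'0) dom_s'. Qed.

Let entry_N (t : state) : t.2`_0 = 1 -> entry t N = 1 + tr t.1.
Proof. by move=> t0; rewrite /entry ltnn t0. Qed.

(** The trace of [s'.1] is about [lam ^+ m * x s'.1], and [kR * x s'.1] is at least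
    [(1 - del) * lam * x s.1]; [del_lam] absorbs all relative errors. *)
Let mono_last : tr s.1 <= k%:Z * tr s'.1.
Proof.
rewrite -(ler_int algR) intrM -[(k%:Z)%:~R]/kR.
have H1 := tr_bound (ltW x0) (adm_dom Is).
move: H1 tr_s'; rewrite !ler_norml => /andP[_ H1] /andP[H2 _].
have lm : 0 < lam ^+ m by rewrite exprn_gt0.
have k0 := lt_le_trans ltr01 kR1.
have H3 := ler_wpM2l (ltW k0) H2.
have H4 : kR * r <= del * (lam * x s.1).
  case: kX_le => kX _; rewrite -(ler_pM2r X_gt0).
  have := ler_wpM2r (le_trans ler01 r_ge1) kX; have := ler_wpM2r (ltW (mulr_gt0 lam_gt0 x0)) Hdel.
  by lra.
have H5 : lam * x s.1 * (1 - del) <= kR * x s'.1.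
  by move: err_x; rewrite ler_norml => /andP[]; lra.
have d1 : 0 <= 1 - del by have := del_lt; lra.
have H6 := ler_wpM2l d1 H5.
have H7 := ler_wpM2r (ltW x0) del_lam.
have H8 : (1 + del) * x s.1 <= (1 - del) * (kR * x s'.1).
  apply: le_trans H6; apply: le_trans H7 _.
  by rewrite le_eqVlt; apply/orP; left; apply/eqP; ring.
have H9 := ler_wpM2l (ltW lm) H8.
by lra.
Qed.

Lemma adm_piece : admissible s'.
Proof.
split=> //.
- move=> i iN; have [iN' | ] := ltnP i.+1 N.
    rewrite !entry_s' //; apply: lez_pdiv2r; first by [].
    by rewrite lerD2r (adm_mono Is).
  rewrite leq_eqVlt ltnNge iN orbF => /eqP NE.
  (* Here [i = N - 1]: the appended entry [1 + tr s.1] has been divided by [k] and is compared with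
     the new [1 + tr s'.1]. *)
  rewrite entry_s' // -NE (entry_N (adm_head Is)) (entry_N head_s').
  exact: floor_succ_le jk mono_last.
- move=> i; rewrite leq_eqVlt => /predU1P[-> | iN].
    rewrite (entry_N head_s'); exact: band_last.
  rewrite epsS // entry_s' //.
  apply: (@band_step _ kR (entry s i.+1)%:~R _ X (lam ^+ i) lam
    (x s.1) (x s'.1) r (eps i.+1) th) => //.
  + by rewrite exprn_ge0 // ltW.
  + have := floor_error k_gt0 (entry s i.+1) jk.
    by rewrite -(ler_int algR) intr_norm !rmorphB rmorphM.
  + by rewrite -exprSr; apply: (adm_band Is).
  + have := ler_wpM2l th_ge0 low_s'; rewrite (_ : th * (X / 8) = 3 / 2 * r) //.
    by rewrite /th; field; rewrite gt_eqF.
Qed.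
End Preservation.

(** * The initial state and finiteness *)

Let u0 : {poly int} := iter n mulX 1.
(** The class of t^n takes exactly the value [X] at [lam], and rounding [lam ^+ i] down costs at
    most 1, which is within the slack [X] of the band. *)
Definition init : state := (u0, \poly_(i < N) Num.floor (lam ^+ i)).

Let ev_u0 z : z \in roots -> ev z u0 = z ^+ n.
Proof. by move=> z_r; rewrite (ev_iter_mulX Dp) // /ev rmorph1 hornerC mulr1. Qed.

Let x_u0 : x u0 = X.
Proof.
apply: val_inj; rewrite /= evrE ev_u0 ?mem_head //.
by rewrite /X (rmorphXn algRval).
Qed.

Let size_u0 : (size u0 <= d)%N.
Proof.
rewrite /u0; elim: n => [|l IH] /=; first by rewrite size_poly1.
exact: (mulX_size mon_p Dp d_gt0 IH).
Qed.

Let dom_u0 z : z \in zs -> nrm (ev z u0) <= x u0.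
Proof.
move=> z_zs; rewrite ev_u0 ?inE ?z_zs ?orbT // x_u0 nrmX.
rewrite lerXn2r ?nnegrE ?nrm_ge0 ?(ltW lam_gt0) //.
exact: le_trans (zs_nu z_zs) (ltW nu_lt).
Qed.

Let init_entry i : (i < N)%N -> entry init i = Num.floor (lam ^+ i).
Proof. by move=> iN; rewrite /entry iN /= coef_poly iN. Qed.

Let init_head : init.2`_0 = 1.
Proof. by have := init_entry N_gt0; rewrite /entry N_gt0 => ->; rewrite expr0 floor1. Qed.

Let init_last : entry init N = 1 + tr u0.
Proof. by rewrite /entry ltnn init_head. Qed.

Let tr_u0 : `|(tr u0)%:~R - lam ^+ m * X| <= del * (lam ^+ m * X).
Proof. by rewrite -x_u0; apply: tr_bound dom_u0; rewrite x_u0 ltW. Qed.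

Lemma adm_init : admissible init.
Proof.
split.
- exact: size_u0.
- exact: size_poly.
- exact: init_head.
- move=> i iN; have [iN' | ] := ltnP i.+1 N.
    rewrite !init_entry //; apply: le_floor.
    by rewrite exprSr ler_peMr ?exprn_ge0 // ltW.
  rewrite leq_eqVlt ltnNge iN orbF => /eqP NE; rewrite init_entry // -NE init_last.
  rewrite -(ler_int algR); apply: le_trans (floor_le _) _.
  have := tr_u0; rewrite -lamN ler_norml NE exprSr rmorphD /= => /andP[H _].
  have H1 : 1 <= lam * (1 - del).
    have d1 : 0 < 1 - del by have := del_lt; lra.
    rewrite -(ler_pM2l d1) mulr1; apply: le_trans del_lam.
    by have := del_gt0; generalize del => e; lra.
  move: H; rewrite mulr1z; set y := lam ^+ i => H.
  have H2 : y <= y * (lam * (1 - del)) by rewrite ler_peMr // exprn_ge0 // ltW.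
  by move: H H2; clearbody y; generalize del => e; lra.
- move=> i; rewrite /= x_u0 leq_eqVlt => /predU1P[-> | iN].
    by rewrite init_last; apply: band_last.
  rewrite init_entry // -mulrBl normrM (gtr0_norm X_gt0).
  have H : `|(Num.floor (lam ^+ i))%:~R - lam ^+ i| <= 1.
    rewrite ler_norml; have := floor_le (lam ^+ i); have := floorD1_gt (lam ^+ i).
    rewrite rmorphD /=; generalize (lam ^+ i) => y; lra.
  apply: le_trans (_ : X <= _); first by rewrite ler_piMl // ltW.
  by rewrite lerDr (mulr_ge0 (eps_ge0 i)) // mulr_ge0 ?exprn_ge0 ?(ltW lam_gt0) ?(ltW X_gt0).
- by rewrite /= x_u0 ler_pdivrMr // ler_peMr ?ler1n // ltW.
- exact: dom_u0.
Qed.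

(** All u(z) are at most [4 * X] in modulus, and interpolation recovers the coefficients of u from
    them; the band bounds the entries. *)
Lemma adm_finite : exists l : seq state, forall s, admissible s -> s \in l.
Proof.
pose C : algR := 4 * X * \sum_(z <- roots) \sum_(i < d)
  nrm ((cofactor_poly roots z)`_i / (cofactor_poly roots z).[z]).
pose E : algR := 6 * lam ^+ N + 1.
have HC : 0 <= C.
  rewrite mulr_ge0 // ?(mulr_ge0 _ (ltW X_gt0)) //.
  by apply: sumr_ge0 => z _; apply: sumr_ge0 => i _; apply: nrm_ge0.
have HE : 0 <= E by rewrite addr_ge0 // mulr_ge0 // exprn_ge0 // ltW.
have [l1 Hl1] := int_poly_box d (Num.bound C).
have [l2 Hl2] := int_poly_box N (Num.bound E).
exists [seq (u, v) | u <- l1, v <- l2] => s Is.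
rewrite [s]surjective_pairing; apply: allpairs_f.
  apply: Hl1 => [|i]; first exact: adm_size1.
  rewrite -(ler_int algR) -nrm_int; apply: le_trans (ltW (archi_boundP HC)).
  have [lt_id | le_di] := ltnP i d; last first.
    by rewrite nth_default ?(leq_trans (adm_size1 Is)) // nrm_int normr0.
  rewrite -coef_map (interpolation uniq_roots (f := map_poly intr s.1)); last first.
    exact: leq_trans (size_poly _ _) (adm_size1 Is).
  rewrite coef_sum; apply: le_trans (nrm_sum _ _ _) _.
  rewrite /C big_distrr /= big_seq [leRHS]big_seq; apply: ler_sum => z z_r.
  rewrite coefZ -/(ev z s.1) mulrAC -mulrA nrmM; apply: ler_pM; rewrite ?nrm_ge0 //.
    apply: le_trans (adm_upper Is); move: z_r; rewrite inE => /predU1P[-> | /(adm_dom Is) //].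
    by rewrite -evrE nrm_algR gtr0_norm // adm_gt0.
  rewrite (bigD1 (Ordinal lt_id)) //= lerDl sumr_ge0 // => j _; exact: nrm_ge0.
apply: Hl2 => [|i]; first exact: adm_size2.
rewrite -(ler_int algR); apply: le_trans (ltW (archi_boundP HE)).
have [lt_iN | le_Ni] := ltnP i N; last first.
  by rewrite nth_default ?(leq_trans (adm_size2 Is)) // normr0.
have -> : s.2`_i = entry s i by rewrite /entry lt_iN.
rewrite ger0_norm; last by apply: le_trans (adm_entry_ge1 Is (ltnW lt_iN)).
have := adm_band Is (ltnW lt_iN); rewrite ler_norml => /andP[_ H].
have y0 : 0 <= lam ^+ i * x s.1.
  by rewrite mulr_ge0 ?exprn_ge0 ?(ltW (adm_gt0 Is)) ?(ltW lam_gt0).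
have H1 := ler_wpM2r y0 (eps_le i).
have H2 : lam ^+ i * x s.1 <= lam ^+ N * (4 * X).
  apply: ler_pM; rewrite ?exprn_ge0 ?(ltW (adm_gt0 Is)) ?(ltW lam_gt0) ?adm_upper //.
  by rewrite ler_weXn2l ?(ltW lam_gt1) // ltnW.
rewrite -(ler_pM2r X_gt0) /E; move: H H1 H2.
generalize (eps i) (lam ^+ i * x s.1) (lam ^+ N) => e y yN.
by lra.
Qed.

End Invariant.

(** * The endomorphism *)

Lemma expr_dominates_linear (F : archiRealFieldType) (l C : F) : 1 < l -> 0 <= C ->
  exists n, C * n.+1%:R <= l ^+ n.
Proof.
move=> l1 C0; pose t := (l - 1) / 2; have t0 : 0 < t by rewrite divr_gt0 // subr_gt0.
have tl : 1 + t < l by rewrite /t; lra.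
have [n Hn] := geometric_dominates (C + C / t) (ltW (addr_gt0 ltr01 t0)) tl.
exists n; apply: le_trans (Hn n (leqnn n)).
have := bernoulli_exp n ler01 (ltW t0); rewrite expr1n mul1r mulr1 => H.
have Ct : 0 <= C / t by rewrite divr_ge0 // ltW.
apply: le_trans (ler_wpM2l (addr_ge0 C0 Ct) H).
rewrite (_ : (C + C / t) * (1 + n%:R * t) = C * n.+1%:R + (C * n%:R * t + C / t)); last first.
  by rewrite -natr1; field; rewrite gt_eqF.
by rewrite lerDl (addr_ge0 _ Ct) // (mulr_ge0 _ (ltW t0)) // mulr_ge0.
Qed.

Section WordLengths.
Variables (p : {poly int}) (zs : seq algC) (N m : nat).
Hypothesis mon_p : p \is monic.
Hypothesis Dp : map_poly intr p = \prod_(z <- zs) ('X - z%:P) :> {poly algC}.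
Hypothesis uniq_zs : uniq zs.
Hypothesis N_gt0 : (0 < N)%N.
Local Notation step := (step p zs N m).
Local Notation len := (len p zs N m).
Variables (M : nat) (st : 'I_M -> state) (f : 'I_M -> seq 'I_M).
Hypothesis st_head : forall i, (st i).2`_0 = 1.
Hypothesis st_step : forall i, \sum_(i' <- f i) st i' = step (st i).

Lemma size_iter_subst w n :
  (size (iter n (subst f) w))%:Z = \sum_(i <- w) len (st i) n.
Proof.
elim: n w => [|n IH] w.
  rewrite /len /=; under eq_bigr do rewrite st_head.
  by rewrite big_const_seq count_predT iter_addr_0 natz.
rewrite iterSr IH /subst big_flatten /= big_map; apply: eq_bigr => i _.
by rewrite -(len_sum mon_p Dp uniq_zs) st_step lenS.
Qed.

End WordLengths.

Section ExpandingCase.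
Variables (p : {poly int}) (lam : algR) (zs : seq algC).
Hypothesis mon_p : p \is monic.
Hypothesis Dp : map_poly intr p = \prod_(z <- algRval lam :: zs) ('X - z%:P) :> {poly algC}.
Hypothesis uniq_roots : uniq (algRval lam :: zs).
Hypothesis lam_gt1 : 1 < lam.
Hypothesis zs_lt : forall z, z \in zs -> nrm z < lam.

Lemma expanding_endomorphism :
  exists (M : nat) (f : 'I_M -> seq 'I_M) (N : nat), [/\ (0 < M)%N, (0 < N)%N &
    forall i, annihilates (map_poly intr (p * ('X^N - 1)))
        (fun k => (lenseq (fun i => posw (f i)) i k)%:R : rat) /\
      ~ annihilates ('X^N - 1) (fun k => (lenseq (fun i => posw (f i)) i k)%:R : rat)].
Proof.
pose roots := algRval lam :: zs; pose d := size roots.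
pose nu : algR := \big[Num.max/0]_(z <- zs) nrm z.
have lam_gt0 : 0 < lam by apply: lt_trans lam_gt1.
have nu_ge0 : 0 <= nu by apply: bigmax_ge_id.
have nu_lt : nu < lam.
  by rewrite /nu big_seq; elim/big_ind: _ => // a b al bl; rewrite gt_max al.
have zs_nu z : z \in zs -> nrm z <= nu by move=> z_zs; apply: le_bigmax_seq.
pose r : algR := \sum_(i < d) lam ^+ i.
pose del : algR := (lam - 1) / (4 * lam).
have del_gt0 : 0 < del by rewrite divr_gt0 ?subr_gt0 // mulr_gt0.
have r_ge0 : 0 <= r by apply: sumr_ge0 => i _; rewrite exprn_ge0 // ltW.
have gap : 0 < lam - nu by rewrite subr_gt0.
have [m Hm0] := geometric_dominates ((size zs)%:R / del) nu_ge0 nu_lt.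
have Hm : (size zs)%:R * nu ^+ m <= del * lam ^+ m.
  rewrite -(ler_pM2l (x := del^-1)) ?invr_gt0 // mulrA [del^-1 * (del * _)]mulKf ?gt_eqF //.
  by rewrite [del^-1 * _]mulrC; apply: Hm0.
(* Each of the three lower bounds for [X] is one summand. The first also depends on [n] through
   [N = m + n], which is at most [m.+1 * n.+1]; hence the linear factor [n.+1] in [Hn]. *)
pose C : algR := 48 * r * m.+1%:R + 8 * r / del + 16 * r * lam / (lam - nu).
have c1 : 0 <= 48 * r * m.+1%:R by rewrite !mulr_ge0.
have c2 : 0 <= 8 * r / del by rewrite (divr_ge0 _ (ltW del_gt0)) // mulr_ge0.
have c3 : 0 <= 16 * r * lam / (lam - nu).
  by rewrite (divr_ge0 _ (ltW gap)) // (mulr_ge0 _ (ltW lam_gt0)) // mulr_ge0.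
have C0 : 0 <= C by rewrite !addr_ge0.
have [n Hn] := expr_dominates_linear lam_gt1 C0.
have le_C c : 0 <= c -> c <= C -> c <= lam ^+ n.
  move=> c0 cC; apply: le_trans Hn; apply: le_trans cC _.
  by rewrite ler_peMr // ler1n.
have HN : 48 * (m + n)%:R * r <= lam ^+ n.
  apply: le_trans Hn; apply: le_trans (_ : 48 * r * m.+1%:R * n.+1%:R <= _); last first.
    by rewrite ler_wpM2r // /C -addrA lerDl addr_ge0.
  rewrite mulrAC -[leRHS]mulrA ler_wpM2l ?mulr_ge0 // -natrM ler_nat.
  by rewrite mulSn addnC leq_add // leq_pmulr.
have Hdel : 8 * r <= del * lam ^+ n.
  rewrite [leRHS]mulrC -ler_pdivrMr //; apply: le_C => //.
  by rewrite /C addrAC lerDr addr_ge0.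
have Hgap : 16 * r * lam <= (lam - nu) * lam ^+ n.
  rewrite [leRHS]mulrC -ler_pdivrMr //; apply: le_C => //.
  by rewrite /C lerDr addr_ge0.
pose N := (m + n)%N; pose I := admissible p lam zs m n.
have I_init : I (init p lam zs m n) by apply: (adm_init mon_p Dp uniq_roots lam_gt1 nu_lt).
have [l Hl] : exists l : seq state, forall s, I s -> s \in l.
  exact: (adm_finite p uniq_roots lam_gt1 HN Hdel).
have N_gt0 : (0 < N)%N.
  exact: (period_gt0 lam_gt1 m Hdel).
pose S := [seq s <- l | `[< I s >]].
have SP s : (s \in S) = `[< I s >].
  by rewrite mem_filter; case: asboolP => //= /Hl.
have M_gt0 : (0 < size S)%N.
  have : init p lam zs m n \in S by rewrite SP; apply/asboolP.
  by case: (S).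
pose s0 : state := (0, 0).
pose st (i : 'I_(size S)) := nth s0 S i.
have stI i : I (st i) by apply/asboolP; rewrite -SP mem_nth.
pose idx (i : 'I_(size S)) s : 'I_(size S) := insubd i (index s S).
have idxK i s : I s -> st (idx i s) = s.
  move=> Is; have sS : s \in S by rewrite SP; apply/asboolP.
  by rewrite /st /idx val_insubd index_mem sS nth_index.
pose k i : nat := `|entry p roots N m (st i) 1|%N.
pose f i := [seq idx i (piece roots N (k i) (step p roots N m (st i)) j) | j <- iota 0 (k i)].
have kE i : entry p roots N m (st i) 1 = (k i)%:Z.
  by rewrite gez0_abs // (le_trans _ (adm_entry_ge1 lam_gt1 Hdel (stI i) N_gt0)).
have k_gt0 i : (0 < k i)%N.
  by rewrite -ltz_nat -kE; apply: (adm_entry_ge1 lam_gt1 Hdel (stI i) N_gt0).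
have st_head i : (st i).2`_0 = 1 by apply: adm_head (stI i).
have st_step i : \sum_(i' <- f i) st i' = step p roots N m (st i).
  have d_gt0 : (0 < d)%N by [].
  rewrite -[RHS](sum_piece (zs := roots) (N := N) (k_gt0 i)); last first.
  - exact: size_poly.
  - exact: (mulX_size mon_p Dp d_gt0 (adm_size1 (stI i))).
  rewrite -(big_mkord xpredT (piece roots N (k i) (step p roots N m (st i)))).
  rewrite /index_iota subn0 big_map; apply: eq_big_seq => j.
  rewrite mem_iota => /andP[_ jk]; rewrite idxK //.
  exact: (adm_piece mon_p Dp uniq_roots lam_gt1 nu_lt nu_ge0 zs_nu Hm HN Hdel Hgap (stI i) jk).
(* [lenseq] starts at the first iterate of phi, hence the additional [step]. *)
have lenE i j : (lenseq (fun i => posw (f i)) i j)%:R =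
    (len p roots N m (step p roots N m (st i)) j)%:~R :> rat.
  rewrite lenseq_posw -lenS -[_%:R]/(_%:Z%:~R).
  by rewrite (size_iter_subst mon_p Dp uniq_roots st_head st_step) big_seq1.
exists (size S), f, N; split=> // i; split=> [|annXN].
  by move=> j; rewrite (act_ext _ (lenE i)) (len_annihilated mon_p Dp uniq_roots).
(* If ['X^N - 1] annihilated the sequence, the trace of [u] below would vanish; but by [tr_bound]
   its relative distance from the positive number lam^m u(lam) is at most [del < 1]. *)
have := annXN 0%N; rewrite (act_ext _ (lenE i)) actD act_Xn -polyC1 -polyCN actC mulN1r.
rewrite -rmorphB /= len_addN // addrAC subrr add0r => /eqP.
rewrite intr_eq0 => /eqP tr0; have := stI i => Is.
set u := mulX p roots (st i).1 in tr0.
have root_lam : algRval lam \in roots by apply: mem_head.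
have x_u : evr lam u = lam * evr lam (st i).1.
  by apply: val_inj; rewrite /= !evrE (ev_mulX Dp).
have x_gt0 : 0 < evr lam u by rewrite x_u mulr_gt0 // (adm_gt0 lam_gt1 Is).
have dom z : z \in zs -> nrm (ev z u) <= evr lam u.
  move=> z_zs; rewrite (ev_mulX Dp) ?inE ?z_zs ?orbT // nrmM x_u.
  by rewrite ler_pM ?nrm_ge0 ?(adm_dom Is) // (le_trans (zs_nu _ z_zs)) // ltW.
have := tr_bound mon_p Dp uniq_roots nu_ge0 zs_nu Hm (ltW x_gt0) dom.
rewrite tr0 sub0r normrN gtr0_norm ?mulr_gt0 ?exprn_gt0 //.
rewrite ler_pMl ?mulr_gt0 ?exprn_gt0 // leNgt.
by rewrite ltr_pdivrMr ?mulr_gt0 // mul1r; have := lam_gt1; lra.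
Qed.
End ExpandingCase.

(** Reduces the theorem to a separable annihilator over the rationals whose cyclotomic part alone
    does not annihilate; recurrence, minimality and growth all follow from the cofactor found by
    [cyclotomic_cofactor]. *)
Lemma growth_conclusion (p : {poly int}) (s0 : seq nat) (a : nat -> nat) :
    p \is monic -> irreducible_poly (map_poly intr p : {poly rat}) ->
    all (fun n => 0 < n)%N s0 ->
    separable_poly (map_poly intr (p * \prod_(n <- s0) 'Phi_n) : {poly rat}) ->
    annihilates (map_poly intr (p * \prod_(n <- s0) 'Phi_n)) (fun n => (a n)%:R : rat) ->
    ~ annihilates (map_poly intr (\prod_(n <- s0) 'Phi_n)) (fun n => (a n)%:R : rat) ->
  [/\ linearly_recurrent a,
      (exists s : seq nat, all (fun n => 0 < n)%N s /\
         is_min_poly a (map_poly intr (p * \prod_(n <- s) 'Phi_n)))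
    & forall R : realType,
        (forall k : nat, (GR R a k <= (Mahler R p)%:E)%E) /\
        (exists k : nat, GR R a k = (Mahler R p)%:E)].
Proof.
move=> mon_p irr_p s0_gt0; rewrite rmorphM !rmorph_prod /= => sep0 ann0 nann0.
have [s s_gt0 []] := cyclotomic_cofactor irr_p s0_gt0 sep0 ann0 nann0.
have DQ (K : nzRingType) : map_poly intr p * \prod_(n <- s) map_poly intr 'Phi_n
    = map_poly intr (p * \prod_(n <- s) 'Phi_n) :> {poly K}.
  by rewrite rmorphM rmorph_prod.
rewrite !DQ => sep_s ann_s min_s.
have mon_q : map_poly intr (p * \prod_(n <- s) 'Phi_n) \is @monic algC.
  by rewrite monic_map // monicMl // monic_prod // => n _; apply: Cyclotomic_monic.
have rec_q : lrec_rel a (map_poly intr (p * \prod_(n <- s) 'Phi_n)).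
  exact: (ann_ext ann_s).
split; first by eexists; split; [exact: mon_q | exact: rec_q].
  exists s; split=> //; split=> // r mon_r rec_r.
  exact: (min_poly_ext mon_p ann_s min_s mon_r rec_r).
by move=> R; apply: (GR_Mahler R mon_p s_gt0 sep_s ann_s min_s).
Qed.

Lemma irreducible_separable (F : numFieldType) (f : {poly F}) :
  irreducible_poly f -> separable_poly f.
Proof.
move=> irr_f; rewrite unlock; apply: irreducible_coprimep => //.
have f_gt1 : (1 < size f)%N by case: irr_f.
apply: contraTN (f_gt1) => f_dv.
have f0 : f != 0 by rewrite -size_poly_gt0 ltnW.
have [/eqP f'0 | f'0] := boolP (f^`() == 0).
  rewrite -leqNgt leqNgt; apply/negP => _.
  have := congr1 (fun g : {poly F} => g`_(size f).-2) f'0.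
  rewrite coef_deriv coef0.
  have -> : (size f).-2.+1 = (size f).-1 by move: f_gt1; case: size => [|[]].
  rewrite -lead_coefE => /eqP; rewrite mulrn_eq0 lead_coef_eq0 (negPf f0) orbF.
  by move: f_gt1; case: size => [|[]].
by have := dvdp_leq f'0 f_dv; rewrite leqNgt lt_size_deriv.
Qed.

(** The constant coefficient is an integer, up to sign the product of the roots. A second root would
    make its modulus less than 1, so ['X] would divide the irreducible [p] of degree at least 2.
    Without a second root, [l] is a positive integer and at most 1. *)
Lemma perron_trivial (p : {poly int}) (rs : seq algC) (l : algC) :
    irreducible_poly (map_poly intr p : {poly rat}) ->
    map_poly intr p = \prod_(z <- l :: rs) ('X - z%:P) :> {poly algC} ->
    0 < l -> l <= 1 -> (forall z, z \in rs -> `|z| < l) ->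
  p = 'X - 1.
Proof.
move=> irr_p Dp l_gt0 l_le1 rs_lt.
have Dc : (p`_0)%:~R = \prod_(z <- l :: rs) - z :> algC.
  rewrite -coef_map Dp -horner_coef0 horner_prod; apply: eq_bigr => z _.
  by rewrite hornerXsubC sub0r.
case: rs => [|z rs] in Dp Dc rs_lt *.
  have l1 : l = 1.
    apply/eqP; rewrite eq_le l_le1 /=; move: Dc; rewrite big_seq1 => Dc.
    have Dl : l = (- p`_0)%:~R by rewrite rmorphN /= Dc opprK.
    by move: l_gt0; rewrite Dl ltr0z ler1z.
  apply: (map_inj_poly (intr_inj : injective (intr : int -> algC))) => //.
  by rewrite Dp big_seq1 l1 polyC1 rmorphB rmorph1 /= map_polyX.
have p0 : p`_0 = 0.
  apply/eqP; apply: contraT => p0.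
  have : `|(p`_0)%:~R : algC| < 1.
    rewrite Dc normr_prod !big_cons !normrN (gtr0_norm l_gt0).
    have rs_le1 : \prod_(j <- rs) `|- j| <= 1.
      rewrite big_seq; apply: prodr_ile1 => w w_rs.
      by rewrite normr_ge0 normrN (le_trans _ l_le1) // ltW // rs_lt // inE w_rs orbT.
    have z1 : `|z| < 1 by apply: lt_le_trans l_le1; apply: rs_lt; apply: mem_head.
    apply: le_lt_trans z1; rewrite mulrCA ler_piMr ?normr_ge0 // mulr_ile1 // ?(ltW l_gt0) //.
    by rewrite prodr_ge0.
  by rewrite -intr_norm ltrz1 ltNge -gtz0_ge1 normr_gt0 p0.
have size_p : (2 < size (map_poly intr p : {poly rat}))%N.
  rewrite size_map_inj_poly ?rmorph0 //; last exact: intr_inj.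
  rewrite -(size_map_inj_poly (intr_inj : injective (intr : int -> algC))) // Dp size_prod_XsubC.
  by [].
case: irr_p => _ /(_ 'X); rewrite size_polyX => /(_ isT).
have -> : 'X %| (map_poly intr p : {poly rat}).
  by rewrite -['X]subr0 -polyC0 dvdp_XsubCl /root horner_coef0 coef_map p0.
by move=> /(_ isT)/eqp_size; rewrite size_polyX => E; rewrite -E in size_p.
Qed.

Theorem theorem5p3 (p : {poly int}) :
  perron p -> irreducible_poly (map_poly intr p : {poly rat}) ->
  exists (m : nat) (imgs : 'I_m -> seq (letter m)),
    (0 < m)%N /\
    forall i : 'I_m,
      [/\ linearly_recurrent (lenseq imgs i),
          (exists s : seq nat, all (fun n => 0 < n)%N s /\
             is_min_poly (lenseq imgs i)
               (map_poly intr (p * \prod_(n <- s) 'Phi_n)))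
        & forall R : realType,
            (forall k : nat, (GR R (lenseq imgs i) k <= (Mahler R p)%:E)%E) /\
            (exists k : nat, GR R (lenseq imgs i) k = (Mahler R p)%:E)].
Proof.
move=> [mon_p [l /andP[l_gt0 root_l] l_max]] irr_p.
have sep_p := irreducible_separable irr_p.
have [rs Drs] := closed_field_poly_normal (map_poly intr p : {poly algC}).
rewrite (monicP _) ?monic_map // scale1r in Drs.
have uniq_rs : uniq rs.
  rewrite -separable_prod_XsubC -Drs.
  by rewrite -map_poly_ratr_intr separable_map.
have l_rs : l \in rs by rewrite -root_prod_XsubC -Drs.
pose zs := rem l rs.
have Dp : map_poly intr p = \prod_(z <- l :: zs) ('X - z%:P) :> {poly algC}.
  by rewrite Drs (big_rem l) // big_cons.
have uniq_roots : uniq (l :: zs) by rewrite -(perm_uniq (perm_to_rem l_rs)).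
have zs_lt z : z \in zs -> `|z| < l.
  rewrite mem_rem_uniq // inE => /andP[zl z_rs].
  by apply: l_max => //; rewrite Drs root_prod_XsubC.
have [l_le1 | l_gt1] := real_leP (gtr0_real l_gt0) (@real1 algC).
  have Ep := perron_trivial irr_p Dp l_gt0 l_le1 zs_lt.
  exists 1%N, (fun i => posw [:: i]); split=> // i.
  have len1 k : lenseq (fun i : 'I_1 => posw [:: i]) i k = 1%N.
    rewrite (lenseq_posw (fun i => [:: i])).
    by have -> : iter k.+1 (subst (fun i => [:: i])) [:: i] = [:: i] by elim: k.+1 => //= n ->.
  apply: (growth_conclusion (s0 := [::])) => //; rewrite big_nil ?mulr1 //.
    move=> n; rewrite Ep rmorphB rmorph1 /= map_polyX -['X]expr1 actD act_Xn.
    by rewrite -polyC1 -polyCN actC !len1 mulN1r subrr.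
  by move=> /(_ 0%N); rewrite rmorph1 -polyC1 actC mul1r len1 => /eqP; rewrite oner_eq0.
pose lam : algR := in_algR (gtr0_real l_gt0).
have [m [f [N [m_gt0 N_gt0 Hf]]]] :=
  expanding_endomorphism (lam := lam) mon_p Dp uniq_roots l_gt1 zs_lt.
exists m, (fun i => posw (f i)); split=> // i; have [ann nann] := Hf i.
have DXN (K : nzRingType) :
    map_poly intr (\prod_(n <- divisors N) 'Phi_n) = 'X^N - 1 :> {poly K}.
  by rewrite prod_Cyclotomic // rmorphB rmorph1 /= map_polyXn.
apply: (growth_conclusion (s0 := divisors N)) => //.
- by apply/allP => n; rewrite -dvdn_divisors // => /dvdn_gt0; apply.
- rewrite rmorphM /= DXN separable_mul sep_p separable_Xn_sub_1 ?pnatr_eq0 -?lt0n //=.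
  (* Since [l > 1] is no root of unity, the irreducible [p] is prime to ['X^N - 1], as separability
     of the product requires. *)
  apply: irreducible_coprimep => //; apply/negP => p_dv.
  have : root ('X^N - 1) l.
    rewrite -(dvdp_map (@ratr algC)) map_poly_ratr_intr rmorphB rmorph1 /= map_polyXn in p_dv.
    exact: root_dvdp p_dv root_l.
  rewrite /root !hornerE subr_eq0 => /eqP lN.
  by have := exprn_egt1 N l_gt1; rewrite lN ltxx -lt0n N_gt0.
- by rewrite prod_Cyclotomic.
- by rewrite DXN.
Qed.
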